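(* Let $T$ be a binary tree on $n\geq 12$ vertices. Let $l$ be the smallest positive odd integer such that $f_{T_{rg}^{l}}(r)>3\times 2^{\frac{n-l-1}{2}}-2$, where $r$ denotes the root of the rooted binary tree $T_{rg}^{l}$. Write $\alpha=d_{T_{rg}^{n,l}}\big(C_d(T_{rg}^{n,l}),S_c(T_{rg}^{n,l})\big)$. Then $$d_T(C_d(T),S_c(T))\leq\begin{cases}\alpha & \text{if } \alpha\geq 1,\\ 1 & \text{otherwise.}\end{cases}$$
   Context: All graphs are finite, simple, connected and undirected. A pendant vertex is a vertex of degree $1$. A binary tree is a tree in which every non-pendant vertex has degree $3$ (so its number of vertices is even). Centroid and subtree core: a subtree of $T$ is a (nonempty) connected subgraph of $T$. A branch at $v\in V(T)$ is a maximal subtree of $T$ containing $v$ as a pendant vertex; the weight of $v$ is the maximum number of edges in a branch at $v$; the centroid $C_d(T)$ is the set of vertices of minimum weight. $f_T(v)$ is the number of subtrees of $T$ containing $v$; the subtree core $S_c(T)$ is the set of vertices $v$ for which $f_T(v)$ is maximum. For $X,Y\subseteq V(T)$, $d_T(X,Y)=\min\{d_T(x,y):x\in X,y\in Y\}$. The eccentricity of $v$ is $\max_u d_T(u,v)$. Rooted binary trees: a rooted binary tree is a rooted tree whose root has degree $2$ and in which every other vertex has degree $1$ or $3$; the single-vertex rooted tree is also allowed. The height (level) of a vertex is its distance to the root. A rooted binary tree is ordered if the vertices of each level $l\ge 1$ are linearly ordered so that two vertices at level $l+1$ with different parents are ordered as their parents are at level $l$. A rooted binary tree is rgood if (i) the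 heights of any two of its pendant vertices differ by at most $1$, and (ii) it can be ordered so that the parents of the pendant vertices at the highest level form a final segment in the ordering of the vertices at the next-to-highest level. For each odd $l$ there is, up to isomorphism, exactly one rgood binary tree on $l$ vertices, denoted $T_{rg}^l$. Crg trees: a binary caterpillar is a binary tree having a path such that every vertex not on the path is adjacent to a vertex of the path. For even $n\ge 4$ and odd $l$ with $3\le l<n$, the crg tree $T_{rg}^{n,l}$ is the tree on $n$ vertices obtained by identifying the root of $T_{rg}^l$ with a vertex of maximum eccentricity of a binary caterpillar on $n-l+1$ vertices. *)

(* Defs.v *)
From HB Require Import structures.
From mathcomp Require Import all_boot.

Set Implicit Arguments.
Unset Strict Implicit.
Unset Printing Implicit Defensive.

Record sgraph := SGraph {
  vertex :> finType;
  adj : rel vertex;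
  adj_sym : symmetric adj;
  adj_irrefl : irreflexive adj }.

Section Graph.
Variable G : sgraph.
Implicit Types (u v x y : G) (X Y : {set G}).

Definition deg v := #|[set u | adj v u]|.

Definition pendant v := deg v == 1.

Definition connected_graph := forall x y, connect (@adj G) x y.

(* [ucycle] also accepts sequences of length at most 2 (a single edge walked
   back and forth); these are not cycles of a simple graph. *)
Definition acyclic := forall c : seq G, ucycle (@adj G) c -> size c <= 2.

Definition tree := connected_graph /\ acyclic.

Definition binary_tree := tree /\ (forall v, ~~ pendant v -> deg v = 3).

(* The least length of a walk from x to y. In a connected graph it is always
   smaller than #|G|; otherwise #|G| is the default value. *)
Definition dist x y : nat :=
  find (fun k => [exists p : k.-tuple G, path (@adj G) x p && (last x p == y)])
       (iota 0 #|G|).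

(* As dist x y <= #|G|, the neutral element #|G| does not affect the minimum
   when X and Y are nonempty. *)
Definition dist_set X Y : nat :=
  \big[minn/#|G|]_(x in X) \big[minn/#|G|]_(y in Y) dist x y.

Definition ecc v : nat := \max_(u : G) dist u v.

Definition edges : {set {set G}} :=
  [set e | [exists x, exists y, adj x y && (e == [set x; y])]].

(* A subgraph is a pair of a vertex set and an edge set. *)
Definition is_subgraph (H : {set G} * {set {set G}}) : bool :=
  (H.2 \subset edges) && (cover H.2 \subset H.1).

Definition subadj (H : {set G} * {set {set G}}) : rel G :=
  fun x y => [set x; y] \in H.2.

Definition subtree (H : {set G} * {set {set G}}) : bool :=
  [&& is_subgraph H, H.1 != set0 &
      [forall x in H.1, forall y in H.1, connect (subadj H) x y]].

Definition pendant_in (H : {set G} * {set {set G}}) v : bool :=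
  (v \in H.1) && (#|[set e in H.2 | v \in e]| == 1).

Definition subgraph_le (H K : {set G} * {set {set G}}) : bool :=
  (H.1 \subset K.1) && (H.2 \subset K.2).

Definition branch v (B : {set G} * {set {set G}}) : bool :=
  [&& subtree B, pendant_in B v &
      [forall K, [&& subtree K, pendant_in K v & subgraph_le B K] ==> (K == B)]].

Definition weight v : nat := \max_(B | branch v B) #|B.2|.

Definition centroid : {set G} := [set v | [forall u, weight v <= weight u]].

Definition nsubtrees v : nat := #|[set H | subtree H & v \in H.1]|.

Definition subtree_core : {set G} :=
  [set v | [forall u, nsubtrees u <= nsubtrees v]].

Definition binary_caterpillar :=
  binary_tree /\
  exists x (p : seq G),
    [/\ path (@adj G) x p, uniq (x :: p) &
        forall v, v \notin x :: p -> exists2 u, u \in x :: p & adj u v].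

Section Rooted.
Variable r : G.

Definition rooted_binary_tree :=
  tree /\
  (#|G| = 1 \/
   deg r = 2 /\ forall v, v != r -> deg v = 1 \/ deg v = 3).

Definition level (h : nat) : {set G} := [set v | dist r v == h].

Definition is_parent p x : bool := adj p x && (dist r x == (dist r p).+1).

(* Only the restrictions of [le] to the levels h >= 1 are relevant. *)
Definition level_order (le : rel G) :=
  (forall h, 0 < h ->
     [/\ {in level h &, total le}, {in level h &, antisymmetric le} &
         {in level h & &, transitive le}]) /\
  (forall h, 0 < h -> {in level h.+1 &, forall x y, forall p q,
     is_parent p x -> is_parent q y -> p != q -> le x y = le p q}).

Definition height : nat := \max_(v : G) dist r v.

Definition deepest_parent p : bool :=
  [exists x in level height, pendant x && is_parent p x].

(* The one-vertex tree has height 0 and no pendant vertex, so that it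
   satisfies both conditions vacuously. *)
Definition rgood :=
  [/\ rooted_binary_tree,
      forall x y, pendant x -> pendant y -> dist r x <= (dist r y).+1 &
      exists2 le : rel G, level_order le &
        forall h, height = h.+1 ->
          {in level h &, forall p q, deepest_parent p -> le p q ->
             deepest_parent q}].

End Rooted.
End Graph.

(* The disjoint union of G and H with the vertices r and c identified; the
   common vertex is represented by r. *)
Section Glue.
Variables (G H : sgraph) (r : G) (c : H).

Definition glue_adj (x y : G + {v : H | v != c}) : bool :=
  match x, y with
  | inl a, inl b => adj a b
  | inl a, inr b => (a == r) && adj c (val b)
  | inr a, inl b => (b == r) && adj (val a) c
  | inr a, inr b => adj (val a) (val b)
  end.

Lemma glue_adj_sym : symmetric glue_adj.
Proof. by case=> a [] b /=; rewrite adj_sym. Qed.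

Lemma glue_adj_irrefl : irreflexive glue_adj.
Proof. by case=> a /=; rewrite adj_irrefl. Qed.

Definition glue : sgraph := SGraph glue_adj_sym glue_adj_irrefl.

End Glue.

(* [rg_tree l r]: the tree carrying r, rooted at r, is a copy of the rgood
   binary tree on l vertices (which is unique up to isomorphism). *)
Definition rg_tree (l : nat) (R : sgraph) (r : R) : Prop :=
  rgood r /\ #|R| = l.

(* [crg_tree n l G]: G is a copy of the crg tree on n vertices. *)
Inductive crg_tree (n l : nat) : sgraph -> Prop :=
  CrgTree (R C : sgraph) (r : R) (c : C) of
      ~~ odd n & 4 <= n & odd l & 3 <= l < n
    & rg_tree l r
    & binary_caterpillar C & #|C| = n - l + 1
    & (forall u : C, ecc u <= ecc c) :
    crg_tree n l (glue r c).

(* For n even and l odd with l < n the subtractions and the halving are exact.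
   For odd l > n the real number 3 * 2 ^ ((n - l - 1) / 2) - 2 is negative and
   its counterpart below is 1, and both are smaller than the number of subtrees
   containing the root as soon as l >= 3. *)
Definition rg_exceeds (n l : nat) : Prop :=
  exists (R : sgraph) (r : R),
    rg_tree l r /\ 3 * 2 ^ ((n - l - 1) %/ 2) - 2 < nsubtrees r.

Definition least_rg_size (n l : nat) : Prop :=
  [/\ odd l, rg_exceeds n l &
      forall l', odd l' -> rg_exceeds n l' -> l <= l'].

(* Main.v *)
Require Import Defs.
From HB Require Import structures.
From mathcomp Require Import all_boot zify.

Set Implicit Arguments.
Unset Strict Implicit.
Unset Printing Implicit Defensive.

(* Take u in the centroid and w in the subtree core at minimal distance k >= 2,
   and let x be the neighbour of w towards u. Removing the edge wx leaves a part
   W containing w in which w lies in strictly more subtrees than x does in the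
   other part. On m vertices a root lies in at most as many subtrees as the root
   of the rgood tree, and in at least as many as the end of a caterpillar, so W
   witnesses the defining inequality of l and l <= |W|. Each inner vertex of the
   path carries a further vertex, while the part of u has more than n/2 vertices;
   hence 2 (|W| + 2 (k - 1)) < n. In the crg tree the same inequality with l in
   place of |W| pushes the centroid at least k steps into the caterpillar, while
   the choice of l keeps the subtree core inside the rgood part.

   With g = 1 + (number of subtrees containing the root), joining two rooted
   trees gives g = 1 + g1 g2. The optimality of rgood trees is thus the
   inequality R i * R j < R (i + j) for their values R, in the number of leaves. *)

(** * The values of rgood shapes *)

(** The inequality R i * R j < R (i + j) is proved by exchanging leaves between two rgood trees. Two
    sizes in one dyadic interval are pushed apart, two sizes in adjacent intervals are drawn towards
    the common endpoint, in both cases until one tree is perfect: the join of the two is then rgood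
    itself and its value is the product plus 1. If the sizes are further apart, the larger tree is
    split at its root and the smaller one is merged with one of the parts. The obstacle is that
    products of values do not recurse to products of values: peeling off perfect subtrees leaves
    affine expressions in the values of the remainders. The exchange statements therefore need a
    form that survives these affine maps. The threshold in the definition of l counts the subtrees
    containing the root of a rooted caterpillar on n - l vertices, that is, with (n - l + 1) / 2
    leaves. Rgood trees of equal size are compared through R alone. *)

Fixpoint full_val h :=
  if h is h'.+1 then (full_val h' * full_val h').+1 else 2.

Fixpoint rgv h m :=
  if h is h'.+1 then
    if m <= 3 * 2 ^ h' then (full_val h' * rgv h' (m - 2 ^ h')).+1
    else (full_val h * rgv h' (m - 2 ^ h)).+1
  else if m <= 1 then 2 else 5.

Lemma full_val_gt1 h : 1 < full_val h.
Proof. by elim: h => //= h IH; nia. Qed.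

Lemma full_valS h : full_val h <= full_val h.+1.
Proof. have := full_val_gt1 h; simpl; nia. Qed.

Lemma leq_full_val h k : h <= k -> full_val h <= full_val k.
Proof. exact: (homo_leq leqnn leq_trans full_valS). Qed.

Lemma rgv_lo h : rgv h (2 ^ h) = full_val h.
Proof.
elim: h => //= h IH; have h0 : 0 < 2 ^ h by rewrite expn_gt0.
rewrite ifT; last by rewrite expnS; lia.
by rewrite expnS (_ : 2 * 2 ^ h - 2 ^ h = 2 ^ h) ?IH //; lia.
Qed.

Lemma rgv_hi h : rgv h (2 ^ h.+1) = full_val h.+1.
Proof.
elim: h => // h IH; have h0 : 0 < 2 ^ h by rewrite expn_gt0.
rewrite [rgv _ _]/= ifF; last by rewrite !expnS; lia.
by rewrite (_ : 2 ^ h.+2 - _ = 2 ^ h.+1) ?IH // !expnS; lia.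
Qed.

Lemma rgv_first h p : 2 ^ h <= p <= 2 ^ h.+1 ->
  rgv h.+1 (2 ^ h + p) = (full_val h * rgv h p).+1.
Proof. by move=> hp /=; rewrite ifT ?addKn //; rewrite expnS in hp; lia. Qed.

Lemma rgv_second h p : 2 ^ h <= p <= 2 ^ h.+1 ->
  rgv h.+1 (2 ^ h.+1 + p) = (full_val h.+1 * rgv h p).+1.
Proof.
(* At the midpoint [3 * 2 ^ h] the definition takes the first branch; either reading joins the
   perfect trees of heights [h] and [h.+1]. *)
move=> hp; have [->|ne_p] := eqVneq p (2 ^ h).
  rewrite addnC rgv_first; last by rewrite leqnn leq_exp2l ?leqnSn.
  by rewrite rgv_hi rgv_lo mulnC.
by rewrite [rgv _ _]/= ifF ?addKn; last by rewrite expnS in hp *; lia.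
Qed.

Lemma rgv_cases h m : 2 ^ h.+1 <= m <= 2 ^ h.+2 ->
  exists2 p, 2 ^ h <= p <= 2 ^ h.+1 & m = 2 ^ h + p \/ m = 2 ^ h.+1 + p.
Proof.
move=> hm; rewrite !expnS in hm *; case: (leqP m (3 * 2 ^ h)) => hm'.
  by exists (m - 2 ^ h); [lia | left; lia].
by exists (m - 2 * 2 ^ h); [lia | right; lia].
Qed.

Lemma rgv_mono h i j : 2 ^ h <= i -> i <= j -> j <= 2 ^ h.+1 ->
  rgv h i <= rgv h j.
Proof.
elim: h i j => [|h IH] i j hi ij hj; first by rewrite /=; do 2!case: ifP; lia.
have [|p hp ip] := @rgv_cases h i; first by lia.
have [|q hq jq] := @rgv_cases h j; first by lia.
have h0 : 0 < 2 ^ h by rewrite expn_gt0.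
case/andP: hp (hp) => hp1 hp2 hp; case/andP: hq (hq) => hq1 hq2 hq.
have cC := full_valS h.
have yc : full_val h <= rgv h q by rewrite -rgv_lo IH.
have xC : rgv h p <= full_val h.+1 by rewrite -rgv_hi IH.
case: ip jq ij => -> [] -> ij; rewrite ?rgv_first ?rgv_second // ltnS.
- by rewrite leq_mul2l IH ?orbT //; lia.
- by rewrite [leqLHS]mulnC leq_mul.
(* With [i] in the upper half and [j] in the lower one, both are the midpoint. *)
- have pE : p = 2 ^ h by move: ij hp1 hq2; rewrite expnS; lia.
  have qE : q = 2 ^ h.+1 by move: ij hp1 hq2; rewrite expnS; lia.
  by rewrite pE qE rgv_hi rgv_lo mulnC.
- by rewrite leq_mul2l IH ?orbT //; lia.
Qed.

Lemma rgv_ge h i : 2 ^ h <= i <= 2 ^ h.+1 -> full_val h <= rgv h i.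
Proof. by case/andP=> i1 i2; rewrite -rgv_lo rgv_mono. Qed.

Lemma rgv_le h i : 2 ^ h <= i <= 2 ^ h.+1 -> rgv h i <= full_val h.+1.
Proof. by case/andP=> i1 i2; rewrite -rgv_hi rgv_mono. Qed.

(* A pair with smaller minimum and larger product also has larger sum, so the
   product inequality survives the affine maps of the recursion. *)
Lemma spread_mul (c C x y x' y' : nat) : 0 < x' -> x' <= x -> x' <= y ->
  y <= y' -> c <= C -> x * y <= x' * y' ->
  (c * x).+1 * (C * y).+1 <= (c * x').+1 * (C * y').+1.
Proof.
move=> x0 xx xy yy cC pr.
have sum : x + y <= x' + y' by nia.
have : c * x + C * y <= c * x' + C * y' by nia.
have : c * C * (x * y) <= c * C * (x' * y') by rewrite leq_mul.
by rewrite !mulSn !mulnS; nia.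
Qed.

(** Leaves are moved from the smaller tree to the larger one until one of them is perfect. Perfect
    parts are peeled off both factors and the remainders are spread by induction; a size that gets
    stuck at the midpoint is read in the other half, where the exchange goes on. *)
Lemma rgv_spread h i j : 2 ^ h <= i -> i <= j -> j <= 2 ^ h.+1 ->
  exists i' j', [/\ i' + j' = i + j, 2 ^ h <= i' <= i, j <= j' <= 2 ^ h.+1,
    i' = 2 ^ h \/ j' = 2 ^ h.+1 & rgv h i * rgv h j <= rgv h i' * rgv h j'].
Proof.
elim: h i j => [|h IH] i j hi ij hj.
  exists i, j; split=> //; [lia|lia|].
  by rewrite /= expn0 expn1 in hi hj *; lia.
have h0 : 0 < 2 ^ h by rewrite expn_gt0.
have E2 := expnS 2 h.+1; have E1 := expnS 2 h.
(* One size in each half. The remainders may come in either order; after spreading, the smaller one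
   goes next to the smaller perfect part, so that sorting and spreading form a single exchange. *)
have FS p q : 2 ^ h <= p <= 2 ^ h.+1 -> 2 ^ h <= q <= 2 ^ h.+1 ->
  exists i' j', [/\ i' + j' = (2 ^ h + p) + (2 ^ h.+1 + q),
    2 ^ h.+1 <= i' <= 2 ^ h + p, 2 ^ h.+1 + q <= j' <= 2 ^ h.+2,
    i' = 2 ^ h.+1 \/ j' = 2 ^ h.+2 &
    rgv h.+1 (2 ^ h + p) * rgv h.+1 (2 ^ h.+1 + q) <=
      rgv h.+1 i' * rgv h.+1 j'].
  move=> hp hq.
  have [p' [q' [eqs hp' hq' ext [pr le1 le2]]]] : exists p' q',
    [/\ p' + q' = p + q, 2 ^ h <= p' <= p, q <= q' <= 2 ^ h.+1,
     p' = 2 ^ h \/ q' = 2 ^ h.+1 &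
     [/\ rgv h p * rgv h q <= rgv h p' * rgv h q', p' <= q & p <= q']].
    case: (leqP p q) => pq.
      have [|||p' [q' [? ? ? ? ?]]] := IH p q; [lia|lia|lia|].
      by exists p', q'; split=> //; split=> //; lia.
    have [|||p' [q' [? ? ? ? ?]]] := IH q p; [lia|lia|lia|].
    exists p', q'; split=> //; [lia|lia|lia|].
    by rewrite [rgv h p * _]mulnC; split=> //; lia.
  exists (2 ^ h + p'), (2 ^ h.+1 + q'); split.
  - lia.
  - lia.
  - lia.
  - lia.
  - rewrite !rgv_first ?rgv_second //; try lia.
    apply: spread_mul => //.
    + by rewrite (leq_trans _ (rgv_ge _)) ?(ltnW (full_val_gt1 _)) //; lia.
    + by apply: rgv_mono; lia.
    + by apply: rgv_mono; lia.
    + by apply: rgv_mono; lia.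
    + exact: full_valS.
have [|p hp ip] := @rgv_cases h i; first by lia.
have [|q hq jq] := @rgv_cases h j; first by lia.
have FF p0 q0 : p0 <= q0 -> 2 ^ h <= p0 <= 2 ^ h.+1 ->
  2 ^ h <= q0 <= 2 ^ h.+1 -> i = 2 ^ h + p0 -> j = 2 ^ h + q0 ->
  exists i' j', [/\ i' + j' = i + j, 2 ^ h.+1 <= i' <= i, j <= j' <= 2 ^ h.+2,
    i' = 2 ^ h.+1 \/ j' = 2 ^ h.+2 &
    rgv h.+1 i * rgv h.+1 j <= rgv h.+1 i' * rgv h.+1 j'].
  move=> pq0 hp0 hq0 iE jE.
  have [|||p' [q' [eqs hp' hq' ext pr]]] := IH p0 q0; [lia|lia|lia|].
  have pr' : rgv h.+1 i * rgv h.+1 j <=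
      rgv h.+1 (2 ^ h + p') * rgv h.+1 (2 ^ h + q').
    rewrite iE jE !rgv_first; try lia.
    apply: spread_mul => //.
    + by rewrite (leq_trans _ (rgv_ge _)) ?(ltnW (full_val_gt1 _)) //; lia.
    + by apply: rgv_mono; lia.
    + by apply: rgv_mono; lia.
    + by apply: rgv_mono; lia.
  case: ext => [p'E|q'E].
    by exists (2 ^ h + p'), (2 ^ h + q'); split=> //; lia.
  have [||i' [j' [e1 e2 e3 e4 e5]]] := FS p' (2 ^ h).
  - lia.
  - lia.
  exists i', j'; split=> //.
  - by rewrite e1; lia.
  - lia.
  - lia.
  - apply: leq_trans pr' _; apply: leq_trans e5.
    by rewrite q'E [2 ^ h + 2 ^ h.+1]addnC.
case: ip jq ij => iE [] jE ij.
- by apply: (FF p q) => //; lia.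
- have [i' [j' [e1 e2 e3 e4 e5]]] := FS p q hp hq.
  by exists i', j'; rewrite iE jE.
(* Here [i <= j] forces [i = j = 3 * 2 ^ h], which also lies in the lower half. *)
- apply: (FF (2 ^ h.+1) q) => //; lia.
- have [|||p' [q' [eqs hp' hq' ext pr]]] := IH p q; [lia|lia|lia|].
  have pr' : rgv h.+1 i * rgv h.+1 j <=
      rgv h.+1 (2 ^ h.+1 + p') * rgv h.+1 (2 ^ h.+1 + q').
    rewrite iE jE !rgv_second; try lia.
    apply: spread_mul => //.
    + by rewrite (leq_trans _ (rgv_ge _)) ?(ltnW (full_val_gt1 _)) //; lia.
    + by apply: rgv_mono; lia.
    + by apply: rgv_mono; lia.
    + by apply: rgv_mono; lia.
  case: ext => [p'E|q'E]; last first.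
    exists (2 ^ h.+1 + p'), (2 ^ h.+1 + q').
    by split; [lia|lia|lia|lia|].
  have [||i' [j' [e1 e2 e3 e4 e5]]] := FS (2 ^ h.+1) q'.
  - lia.
  - lia.
  exists i', j'; split=> //.
  - by rewrite e1; lia.
  - lia.
  - lia.
  - apply: leq_trans pr' _; apply: leq_trans e5.
    by rewrite p'E [2 ^ h.+1 + 2 ^ h]addnC.
Qed.

(** * Optimality of the rgood values *)

Definition rg_val m := rgv (trunc_log 2 m) m.

Lemma rg_valE h m : 2 ^ h <= m <= 2 ^ h.+1 -> rg_val m = rgv h m.
Proof.
case/andP=> hm1 hm2; rewrite /rg_val.
have [->|ne] := eqVneq m (2 ^ h.+1); first by rewrite trunc_expnK // rgv_lo rgv_hi.
by rewrite (@trunc_log_eq 2 h) // hm1 ltn_neqAle ne.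
Qed.

Lemma rg_valP m : 0 < m ->
  exists2 h, 2 ^ h <= m < 2 ^ h.+1 & rg_val m = rgv h m.
Proof.
by move=> m0; exists (trunc_log 2 m) => //; rewrite trunc_logP //= trunc_log_ltn.
Qed.

Definition optimal_below M := forall p q, 0 < p -> 0 < q -> p + q < M ->
  rg_val p * rg_val q < rg_val (p + q).

(* The affine maps [a1 + b1 * x] and [a2 + b2 * y] describe how the values of
   two disjoint subtrees enter the value of a larger tree; the recursion peels
   off a perfect subtree next to each of them. *)
Definition gathers h a1 b1 a2 b2 i j :=
  exists i' j', [/\ i' + j' = i + j, i <= i' <= 2 ^ h.+1, 2 ^ h.+1 <= j' <= j,
    i' = 2 ^ h.+1 \/ j' = 2 ^ h.+1 &
    (a1 + b1 * rgv h i) * (a2 + b2 * rgv h.+1 j) <=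
      (a1 + b1 * rgv h i') * (a2 + b2 * rgv h.+1 j')].

(** The perfect part of the second tree takes the place of the first tree, which is merged with the
    remainder [q]; by optimality below [M] the merged tree is worth at least the join. With [x], [y]
    the values of [i], [q] and [C] the perfect value, the exchange gains at least
    [(C - x) * (b1 * (a2 + b2) - a1 * b2 * y)], nonnegative since [y <= C]. *)
Lemma gathers_second M h a1 b1 a2 b2 i q : optimal_below M ->
  2 ^ h <= i <= 2 ^ h.+1 -> 2 ^ h <= q <= 2 ^ h.+1 -> i + (2 ^ h.+1 + q) <= M ->
  full_val h.+1 * a1 * b2 <= b1 * (a2 + b2) ->
  gathers h a1 b1 a2 b2 i (2 ^ h.+1 + q).
Proof.
move=> opt hi hq leM cond.
have [h0 E1 E2] : [/\ 0 < 2 ^ h, 2 ^ h.+1 = 2 * 2 ^ h &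
  2 ^ h.+2 = 2 * 2 ^ h.+1] by rewrite expn_gt0 !expnS.
exists (2 ^ h.+1), (i + q); split; [lia|lia|lia|by left|].
rewrite rgv_hi rgv_second //.
have xyz : rgv h i * rgv h q < rgv h.+1 (i + q).
  rewrite -(rg_valE hi) -(rg_valE hq) -(@rg_valE h.+1); last by lia.
  by apply: opt; lia.
have := rgv_le hi; have := rgv_le hq.
move: (rgv h i) (rgv h q) (rgv h.+1 (i + q)) (full_val _) cond xyz.
move=> x y z C cond xyz yC xC.
apply: (@leq_trans ((a1 + b1 * C) * (a2 + b2 * (x * y).+1))); last first.
  by rewrite leq_mul2l leq_add2l leq_mul2l xyz !orbT.
have key : a1 * b2 * y * (C - x) <= b1 * (a2 + b2) * (C - x).
  rewrite leq_mul2r; apply/orP; right; apply: leq_trans cond.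
  have : a1 * b2 * y <= a1 * b2 * C by rewrite leq_mul2l yC orbT.
  by lia.
by rewrite !mulnBr in key; nia.
Qed.

(** When [i < q], exchanging these two trees gains [(y - x) * (b1 * (a2 + b2) - c * a1 * b2)], where
    [x], [y] are their values and [c] is the perfect value; this reduces the claim to [q0 <= i0]. *)
Lemma gathers_first h a1 b1 a2 b2 i q :
  2 ^ h <= i <= 2 ^ h.+1 -> 2 ^ h <= q <= 2 ^ h.+1 ->
  full_val h * a1 * b2 <= b1 * (a2 + b2) ->
  (forall i0 q0, 2 ^ h <= i0 <= 2 ^ h.+1 -> 2 ^ h <= q0 <= i0 ->
    i0 + q0 = i + q -> q0 <= q -> gathers h a1 b1 a2 b2 i0 (2 ^ h + q0)) ->
  gathers h a1 b1 a2 b2 i (2 ^ h + q).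
Proof.
move=> hi hq cond sorted; have [qi|iq] := leqP q i; first by apply: sorted; lia.
have [||||i' [j' [e1 e2 e3 e4 e5]]] := sorted q i; [lia|lia|lia|lia|].
exists i', j'; split=> //; [lia|lia|lia|]; apply: leq_trans e5.
rewrite !rgv_first //.
have xy : rgv h i <= rgv h q by apply: rgv_mono; lia.
move: (rgv h i) (rgv h q) (full_val _) cond xy => x y c cond xy.
have key : c * a1 * b2 * (y - x) <= b1 * (a2 + b2) * (y - x).
  by rewrite leq_mul2r cond orbT.
by rewrite !mulnBr in key; nia.
Qed.

Lemma gathers_sorted M h a1 b1 a2 b2 i j : optimal_below M ->
  2 ^ h <= i <= 2 ^ h.+1 -> 2 ^ h.+1 <= j <= 2 ^ h.+2 -> i + j <= M ->
  (j <= 3 * 2 ^ h /\ full_val h * a1 * b2 <= b1 * (a2 + b2)) \/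
  full_val h.+1 * a1 * b2 <= b1 * (a2 + b2) ->
  (full_val h * a1 * b2 <= b1 * (a2 + b2) ->
    forall i0 q0, 2 ^ h <= i0 <= 2 ^ h.+1 -> 2 ^ h <= q0 <= i0 ->
    i0 + (2 ^ h + q0) = i + j -> gathers h a1 b1 a2 b2 i0 (2 ^ h + q0)) ->
  gathers h a1 b1 a2 b2 i j.
Proof.
move=> opt hi hj leM cond sorted.
have condc : full_val h * a1 * b2 <= b1 * (a2 + b2).
  case: cond => [[]//|cond]; apply: leq_trans cond.
  by rewrite -!mulnA leq_mul2r full_valS orbT.
have first q : 2 ^ h <= q <= 2 ^ h.+1 -> j = 2 ^ h + q ->
    gathers h a1 b1 a2 b2 i j.
  move=> hq jE; rewrite jE; apply: gathers_first => // i0 q0 hi0 hq0 eqs _.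
  by apply: sorted => //; lia.
have [q hq [|jE]] := rgv_cases hj; first exact: first.
(* Under the weaker condition a size in the upper half can only be [3 * 2 ^ h], which is read in the
   lower half. *)
case: cond => [[j3 _]|cond]; last by rewrite jE; apply: gathers_second opt _ _ _ _; lia.
have E1 := expnS 2 h; apply: (first (2 ^ h.+1)); lia.
Qed.

(** The condition on the coefficients is the one that the recursion reproduces. Peeling perfect
    parts off both trees multiplies [b1] and [b2] by perfect values, and after cancellation the new
    condition is the old one. If the smaller perfect part is peeled off the first tree, the new
    condition comes only in its weaker form, but then [q <= i] keeps the other remainder at or below
    its midpoint: this is the first alternative. *)
Lemma rgv_gather M h a1 b1 a2 b2 i j : optimal_below M ->
  0 < b1 -> 0 < b2 -> 2 ^ h <= i <= 2 ^ h.+1 -> 2 ^ h.+1 <= j <= 2 ^ h.+2 ->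
  i + j <= M ->
  (j <= 3 * 2 ^ h /\ full_val h * a1 * b2 <= b1 * (a2 + b2)) \/
  full_val h.+1 * a1 * b2 <= b1 * (a2 + b2) ->
  gathers h a1 b1 a2 b2 i j.
Proof.
move=> opt; elim: h a1 b1 a2 b2 i j => [|h IH] a1 b1 a2 b2 i j b1_gt0 b2_gt0.
  move=> hi hj ijM cond; apply: (gathers_sorted opt _ _ ijM cond) => //.
  (* Sizes 1 and 2 only: with [q0 <= i0], either [i0 = 2] or the second tree has 2 leaves, so
     nothing has to move. *)
  by move=> _ i0 q0 hi0 hq0 _; exists i0, (2 ^ 0 + q0); split; lia.
move=> hi hj ijM cond; apply: (gathers_sorted opt _ _ ijM cond) => //.
move=> {}cond i0 q0 hi0 hq0 sum0.
have leM : i0 + (2 ^ h.+1 + q0) <= M by lia.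
move: i0 q0 {i j hi hj ijM sum0} hi0 hq0 leM => i q hi hq leM.
have [h0 E1 E2] : [/\ 0 < 2 ^ h, 2 ^ h.+1 = 2 * 2 ^ h &
  2 ^ h.+2 = 2 * 2 ^ h.+1] by rewrite expn_gt0 !expnS.
have C0 := ltnW (full_val_gt1 h.+1); have c0 := ltnW (full_val_gt1 h).
have affine a b c x : a + b * (c * x).+1 = a + b + b * c * x by lia.
have second p0 q0 : 2 ^ h <= p0 <= 2 ^ h.+1 -> 2 ^ h.+1 <= q0 <= 2 ^ h.+2 ->
    p0 + q0 <= M -> gathers h.+1 a1 b1 a2 b2 (2 ^ h.+1 + p0) (2 ^ h.+1 + q0).
  move=> hp0 hq0 leM0.
  have [||||||i' [j' [e1 e2 e3 e4 e5]]] := IH (a1 + b1) (b1 * full_val h.+1)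
    (a2 + b2) (b2 * full_val h.+1) p0 q0 => //.
  - by rewrite muln_gt0 b1_gt0.
  - by rewrite muln_gt0 b2_gt0.
  - by right; nia.
  exists (2 ^ h.+1 + i'), (2 ^ h.+1 + j'); split; try lia.
  rewrite !rgv_second ?rgv_first ?affine //; lia.
have [p hp] := rgv_cases hi.
case=> iE; last by rewrite iE; apply: second; lia.
have [||||||i' [j' [e1 e2 e3 e4 e5]]] := IH (a1 + b1) (b1 * full_val h)
    (a2 + b2) (b2 * full_val h.+1) p q.
- by rewrite muln_gt0 b1_gt0.
- by rewrite muln_gt0 b2_gt0.
- lia.
- lia.
- lia.
- by left; split; [lia|nia].
have le1 : (a1 + b1 * rgv h.+1 i) * (a2 + b2 * rgv h.+2 (2 ^ h.+1 + q)) <=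
  (a1 + b1 * rgv h.+1 (2 ^ h + i')) * (a2 + b2 * rgv h.+2 (2 ^ h.+1 + j')).
  by rewrite iE !rgv_first ?affine //; lia.
case: e4 => [i'E|j'E]; last first.
  by exists (2 ^ h + i'), (2 ^ h.+1 + j'); split=> //; lia.
(* The first tree has reached the midpoint [3 * 2 ^ h]; read as a larger perfect part plus [2 ^ h]
   leaves, it can gather further. *)
have [|||p' [q' [f1 f2 f3 f4 f5]]] := second (2 ^ h) j'; [lia|lia|lia|].
exists p', q'; split; try lia.
by apply: leq_trans le1 _; rewrite i'E [2 ^ h + _]addnC.
Qed.

(** The outer induction is on [i + j], the inner one on the larger size; the latter serves the
    regrouping of sizes that are far apart. *)
Theorem rg_val_optimal i j : 0 < i -> 0 < j ->
  rg_val i * rg_val j < rg_val (i + j).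
Proof.
have [M] := ubnP (i + j); elim: M i j => // M IHM i j.
wlog ij : i j / i <= j.
  move=> H ltM i0 j0; case: (leqP i j) => [|/ltnW] ij; first exact: H.
  by rewrite mulnC addnC; apply: H => //; rewrite addnC.
have [N] := ubnP j; elim: N i j ij => // N IHN i j ij ltN ltM i0 j0.
have opt : optimal_below (i + j) by move=> p q ? ? ?; apply: IHM; lia.
have [h hi' iE] := rg_valP i0.
have hi : 2 ^ h <= i <= 2 ^ h.+1 by lia.
have [h0 E1 E2] : [/\ 0 < 2 ^ h, 2 ^ h.+1 = 2 * 2 ^ h &
  2 ^ h.+2 = 2 * 2 ^ h.+1] by rewrite expn_gt0 !expnS.
have [j1|j1] := leqP j (2 ^ h.+1).
  rewrite iE (@rg_valE h j); last by lia.
  have [|||i' [j' [e1 e2 e3 e4 e5]]] := @rgv_spread h i j; [lia|lia|lia|].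
  apply: (leq_ltn_trans e5); rewrite -e1.
  case: e4 => [i'E|j'E].
    rewrite i'E rgv_lo (@rg_valE h.+1); last by lia.
    by rewrite rgv_first ?ltnS //; lia.
  rewrite j'E rgv_hi addnC (@rg_valE h.+1); last by lia.
  by rewrite rgv_second 1?mulnC ?ltnS //; lia.
have [j2|j2] := leqP j (2 ^ h.+2).
  rewrite iE (@rg_valE h.+1 j); last by lia.
  have [||||||i' [j' [e1 e2 e3 e4 e5]]] := @rgv_gather (i + j) h 0 1 0 1 i j opt.
  - by [].
  - by [].
  - lia.
  - lia.
  - lia.
  - by right; rewrite muln0 mul0n.
  move: e5; rewrite !add0n !mul1n => e5; apply: (leq_ltn_trans e5); rewrite -e1.
  case: e4 => [i'E|j'E].
    rewrite i'E rgv_hi (@rg_valE h.+2); last by rewrite (expnS 2 h.+2); lia.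
    by rewrite rgv_first ?ltnS //; lia.
  rewrite j'E rgv_lo addnC (@rg_valE h.+1); last by lia.
  by rewrite rgv_second 1?mulnC ?ltnS //; lia.
have [k hj' jE] := rg_valP j0.
have hj : 2 ^ k <= j <= 2 ^ k.+1 by lia.
have hk : h.+2 < k.+1 by rewrite -(@ltn_exp2l 2) //; lia.
case: k hk hj jE {hj'} => // k hk hj jE.
have lek : 2 ^ h.+1 <= 2 ^ k by rewrite leq_exp2l.
have ric : rg_val i <= full_val k.
  by rewrite iE (leq_trans (rgv_le hi)) // leq_full_val.
(* Writing R for [rg_val], [R i * (R j1' * R j2' + 1) <= R j1' * (R i * R j2' + 1)] because
   [R i <= R j1']. Two instances of the claim finish: [i] with [j2'] has a smaller sum, and [j1']
   with [i + j2'] has the same sum but a smaller maximum, as [i < j1']. *)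
have [j1' [j2' [p1 p2 jsum jval ij1]]] : exists j1' j2',
    [/\ i < j1', 0 < j2', j = j1' + j2',
      rg_val j = (rg_val j1' * rg_val j2').+1 & rg_val i <= rg_val j1'].
  have rgk m : rg_val (2 ^ m) = full_val m.
    by rewrite (@rg_valE m) ?rgv_lo // leqnn leq_exp2l ?leqnSn.
  have [p hp [pE|pE]] := rgv_cases hj.
    exists (2 ^ k), p; rewrite jE rgk (rg_valE hp) pE rgv_first //.
    by split=> //; lia.
  exists (2 ^ k.+1), p; rewrite jE rgk (rg_valE hp) pE rgv_second //.
  by split=> //; [rewrite expnS; lia|lia|apply: leq_trans ric (full_valS k)].
have inner : rg_val i * rg_val j2' < rg_val (i + j2') by apply: IHM; lia.
have outer : rg_val j1' * rg_val (i + j2') < rg_val (i + j).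
  have -> : i + j = j1' + (i + j2') by lia.
  case: (leqP j1' (i + j2')) => le1; first by apply: IHN; lia.
  by rewrite mulnC [j1' + _]addnC; apply: IHN; lia.
apply: leq_trans outer; rewrite ltnS jval.
by nia.
Qed.

(** * Shapes of rooted binary trees *)

Inductive btree := Leaf | Node of btree & btree.

Fixpoint leaves t := if t is Node t1 t2 then leaves t1 + leaves t2 else 1.

Fixpoint root_subtrees t :=
  if t is Node t1 t2 then (root_subtrees t1).+1 * (root_subtrees t2).+1 else 1.

Lemma leaves_gt0 t : 0 < leaves t.
Proof. by elim: t => //= t1 IH1 t2 IH2; lia. Qed.

Lemma root_subtrees_le t : root_subtrees t < rg_val (leaves t).
Proof.
elim: t => [|t1 IH1 t2 IH2] //=.
apply: leq_ltn_trans (rg_val_optimal (leaves_gt0 t1) (leaves_gt0 t2)).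
exact: leq_mul.
Qed.

(** Caterpillars attain this minimum: joining with a leaf sends the value [g] to [2 * g + 1], so
    [g + 1] doubles with each leaf, starting from 3. *)
Lemma root_subtrees_ge t : 3 * 2 ^ (leaves t).-1 <= (root_subtrees t).+2.
Proof.
elim: t => [|t1 IH1 t2 IH2] //=.
have := leaves_gt0 t1; have := leaves_gt0 t2.
case: (leaves t1) IH1 => // p1 IH1; case: (leaves t2) IH2 => // p2 IH2 _ _.
rewrite addSn addnS /= -addSn expnD expnS in IH1 IH2 *.
have : 0 < 2 ^ p1 by rewrite expn_gt0.
have : 0 < 2 ^ p2 by rewrite expn_gt0.
by move: (2 ^ p1) (2 ^ p2) IH1 IH2; nia.
Qed.

Definition is_leaf t := if t is Leaf then true else false.

Fixpoint caterpillar t :=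
  if t is Node t1 t2 then
    is_leaf t1 && caterpillar t2 || is_leaf t2 && caterpillar t1
  else true.

Lemma root_subtrees_caterpillar t : caterpillar t ->
  (root_subtrees t).+2 = 3 * 2 ^ (leaves t).-1.
Proof.
elim: t => [|t1 IH1 t2 IH2] //= /orP[]/andP[].
  case: t1 {IH1} => //= _ /IH2; have := leaves_gt0 t2.
  by case: (leaves t2) => //= p _; rewrite expnS; lia.
case: t2 {IH2} => //= _ /IH1; have := leaves_gt0 t1.
by case: (leaves t1) => //= p _; rewrite addn1 /= expnS; lia.
Qed.

Fixpoint perfect h := if h is h'.+1 then Node (perfect h') (perfect h') else Leaf.

Lemma leaves_perfect h : leaves (perfect h) = 2 ^ h.
Proof. by elim: h => //= h ->; rewrite expnS; lia. Qed.

Lemma root_subtrees_perfect h : (root_subtrees (perfect h)).+1 = full_val h.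
Proof. by elim: h => //= h ->. Qed.

(* Up to exchanging siblings, the shapes whose leaves have height h or h + 1
   and in which the parents at height h form a final segment. *)
Inductive rg_shape : nat -> btree -> Prop :=
| RgLeaf : rg_shape 0 Leaf
| RgCherry : rg_shape 0 (Node Leaf Leaf)
| RgFirst h t : rg_shape h t -> rg_shape h.+1 (Node (perfect h) t)
| RgSecond h t : rg_shape h t -> rg_shape h.+1 (Node t (perfect h.+1))
| RgSwap h t1 t2 : rg_shape h (Node t1 t2) -> rg_shape h (Node t2 t1).

Lemma rg_shape_val h t : rg_shape h t ->
  2 ^ h <= leaves t <= 2 ^ h.+1 /\ (root_subtrees t).+1 = rgv h (leaves t).
Proof.
elim=> {h t} [||h t _ [hl IH]|h t _ [hl IH]|h t1 t2 _ /= []] //.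
- have E1 := expnS 2 h; have E2 := expnS 2 h.+1.
  split=> [/=|]; first by rewrite leaves_perfect; lia.
  rewrite [leaves _]/= leaves_perfect rgv_first // -IH [root_subtrees _]/=.
  by rewrite root_subtrees_perfect.
- have E1 := expnS 2 h; have E2 := expnS 2 h.+1.
  have lE : leaves (Node t (perfect h.+1)) = 2 ^ h.+1 + leaves t.
    by rewrite /= leaves_perfect; lia.
  split=> [|]; first by rewrite lE; lia.
  rewrite lE rgv_second // -IH mulnC -(root_subtrees_perfect h.+1).
  by rewrite -/(root_subtrees (Node t (perfect h.+1))).
- by move=> hl IH; rewrite addnC mulnC.
Qed.

Lemma root_subtrees_rg_shape h t : rg_shape h t ->
  (root_subtrees t).+1 = rg_val (leaves t).
Proof. by case/rg_shape_val=> hl ->; rewrite (rg_valE hl). Qed.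

(** * Components of a tree after removing vertices *)

Section Paths.
Variable G : sgraph.
Implicit Types (a b c u v x y z : G) (X Y S : {set G}) (p : seq G).

Definition nbrs v := [set u | adj v u].

Definition avoid X : rel G := fun x y => [&& adj x y, x \notin X & y \notin X].

(** A root [a] lying in [X] gives [[set a]]. In a tree with [a] and [b] adjacent, [comp [set b] a]
    is the side of [a] once the edge between them is removed. *)
Definition comp X a := [set x | connect (avoid X) a x].

Lemma adj_neq a b : adj a b -> a != b.
Proof. by apply: contraTneq => ->; rewrite adj_irrefl. Qed.

Lemma avoid_sym X : connect_sym (avoid X).
Proof.
by apply: sym_connect_sym => x y; rewrite /avoid adj_sym; congr andb; exact: andbC.
Qed.

Lemma path_adj X a p : path (avoid X) a p -> path (@adj G) a p.
Proof. by apply: sub_path => x y /and3P[]. Qed.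

Lemma path_avoid_notin X a p : path (avoid X) a p -> {in p, forall x, x \notin X}.
Proof.
elim: p a => //= y p IH a /andP[/and3P[_ _ yX] /IH p_] x.
by rewrite inE => /predU1P[->|/p_].
Qed.

Lemma path_avoid X a p : path (@adj G) a p -> a \notin X ->
  {in p, forall x, x \notin X} -> path (avoid X) a p.
Proof.
elim: p a => //= y p IH a /andP[ay yp] aX pX; have yX := pX y (mem_head _ _).
rewrite /avoid ay aX yX IH // => x xp.
by apply: pX; rewrite inE xp orbT.
Qed.

Lemma mem_comp_root X a : a \in comp X a.
Proof. by rewrite inE connect0. Qed.

Lemma compP X a x : x \in comp X a ->
  exists p, [/\ path (avoid X) a p, last a p = x & uniq (a :: p)].
Proof.
rewrite inE => /connectP[p ap ->]; case/shortenP: ap => q aq uq _.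
by exists q.
Qed.

Lemma path_comp X a p : path (avoid X) a p -> {subset p <= comp X a}.
Proof.
move=> ap x /splitPr xp; case: xp ap => p1 p2; rewrite cat_path /= => /and3P[ap1 e _].
rewrite inE; apply: connect_trans (connect1 e).
by apply/connectP; exists p1.
Qed.

Lemma comp_notin X a x : x \in comp X a -> x != a -> x \notin X.
Proof.
case/compP=> p [ap <- _]; case/lastP: p ap => [|p y ap _]; first by rewrite eqxx.
by rewrite last_rcons; apply: (path_avoid_notin ap); rewrite mem_rcons mem_head.
Qed.

Lemma comp_sub X Y a : (forall y, y \in comp X a -> y \notin Y) ->
  comp X a \subset comp Y a.
Proof.
move=> disj; apply/subsetP=> x /compP[p [ap <- _]]; rewrite inE.
apply/connectP; exists p => //; apply: path_avoid; first exact: path_adj ap.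
  exact/disj/mem_comp_root.
by move=> y /(path_comp ap)/disj.
Qed.

Lemma comp_subW X Y a : X \subset Y -> comp Y a \subset comp X a.
Proof.
move=> /subsetP XY; apply/subsetP=> x; rewrite !inE.
apply: connect_sub => y z /and3P[yz yX zX]; apply: connect1.
by rewrite /avoid yz !(contra (XY _)).
Qed.

Lemma comp_trans X a b : b \in comp X a -> comp X b \subset comp X a.
Proof.
by rewrite inE => ab; apply/subsetP=> x; rewrite !inE; apply: connect_trans.
Qed.

Lemma comp_step X a b : adj a b -> a \notin X -> b \notin X -> b \in comp X a.
Proof. by move=> ab aX bX; rewrite inE connect1 // /avoid ab aX. Qed.

(** A simple path from [a] to [x] either avoids [c], or its part from [c] on avoids [a]. *)
Lemma comp_through X a c x : x \in comp X a -> c != a ->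
  x \in comp (c |: X) a \/ x \in comp [set a] c.
Proof.
move=> /compP[p [ap <- /= /andP[a_p up]]] ca.
have [cp|c_p] := boolP (c \in p).
  right; case/splitPr: cp ap a_p up => p1 p2; rewrite cat_path /=.
  case/and3P=> _ _ cp2; rewrite mem_cat inE !negb_or => /and3P[_ ac a_p2] _.
  rewrite inE last_cat /=; apply/connectP; exists p2 => //.
  apply: path_avoid; rewrite ?inE //; first exact: path_adj cp2.
  by move=> y yp; rewrite inE; apply: contraNneq a_p2 => <-.
left; rewrite inE; apply/connectP; exists p => //.
case: p ap {a_p up} c_p => // y p ap c_p.
have aX : a \notin X by case/andP: ap => /and3P[].
apply: path_avoid; first exact: path_adj ap.
  by rewrite !inE negb_or eq_sym ca.
move=> z zp; rewrite !inE negb_or (path_avoid_notin ap) // andbT.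
by apply: contraNneq c_p => <-.
Qed.

(** The form in which acyclicity is used: distinct neighbours of [v] lie in distinct components
    after the deletion of [v]. *)
Definition arboreal := (forall x y, connect (@adj G) x y) /\
  (forall v a b, adj v a -> adj v b -> b \in comp [set v] a -> a = b).

Lemma tree_arboreal : tree G -> arboreal.
Proof.
case=> conn acyc; split=> // v a b va vb /compP[p [ap lp up]].
apply/eqP/negPn/negP=> ab.
have p_v : v \notin p.
  by apply/negP => /(path_avoid_notin ap); rewrite inE eqxx.
case: p => [|c p] in ap lp up p_v *; first by rewrite -lp eqxx in ab.
suff /acyc : ucycle (@adj G) [:: v, a, c & p] by [].
apply/andP; split; last first.
  by move: up p_v; rewrite /= !inE !negb_or => -> ->; rewrite adj_neq.
rewrite /cycle rcons_path [last _ _]lp [adj b v]adj_sym vb andbT /= va.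
exact: path_adj ap.
Qed.

Hypothesis T : arboreal.

Lemma comp_setT a : comp set0 a = setT.
Proof.
apply/setP=> x; rewrite !inE; have [conn _] := T.
apply: connect_sub (conn a x) => y z yz; apply: connect1.
by rewrite /avoid yz !inE.
Qed.

Lemma comp_nbr_inj v a b x : adj v a -> adj v b ->
  x \in comp [set v] a -> x \in comp [set v] b -> a = b.
Proof.
move=> va vb xa xb; case: T => _ /(_ v a b va vb) -> //.
by apply: (subsetP (comp_trans xa)); rewrite inE avoid_sym; move: xb; rewrite inE.
Qed.

Lemma comp_opp_notin a b : adj a b -> b \notin comp [set b] a.
Proof.
move=> ab; apply/negP=> /comp_notin bX.
by have := adj_neq ab; rewrite eq_sym => /bX; rewrite inE eqxx.
Qed.

Lemma comp_edgeT a b x : adj a b -> (x \in comp [set b] a) || (x \in comp [set a] b).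
Proof.
move=> ab; have : x \in comp set0 a by rewrite comp_setT inE.
case/(@comp_through _ _ b); first by rewrite eq_sym adj_neq.
  by rewrite setU0 => ->.
by move=> ->; rewrite orbT.
Qed.

Lemma comp_edge_disj a b x : adj a b ->
  x \in comp [set b] a -> x \notin comp [set a] b.
Proof.
move=> ab /compP[p [ap <- up]]; apply/negP=> xb.
case: p => [|c p] in ap up xb *.
  have ba : adj b a by rewrite adj_sym.
  by have := comp_opp_notin ba; rewrite xb.
move: (ap) => /= /andP[/and3P[ac _ cb] cp].
suff /(comp_nbr_inj ac ab)/(_ xb) cE : last a (c :: p) \in comp [set a] c.
  by rewrite cE inE eqxx in cb.
rewrite inE; apply/connectP; exists p => //; apply: path_avoid.
- exact: path_adj cp.
- by rewrite inE eq_sym adj_neq.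
- move: up => /= /andP[a_p _] y yp; rewrite inE.
  by apply: contraNneq a_p => <-; rewrite inE yp orbT.
Qed.

Lemma comp_edgeC a b : adj a b -> comp [set a] b = ~: comp [set b] a.
Proof.
move=> ab; apply/setP=> x; rewrite in_setC; have := comp_edgeT x ab.
by case: (boolP (x \in comp [set b] a)) => // xa _; apply/negbTE/comp_edge_disj.
Qed.

Lemma comp_nbr_exists v x : x != v -> exists2 a, adj v a & x \in comp [set v] a.
Proof.
move=> xv; have : x \in comp set0 v by rewrite comp_setT inE.
case/compP=> [[|a p]] [/= vp lx]; first by rewrite lx eqxx in xv.
case/andP: vp => /and3P[va _ _] ap /and3P[v_p _ _]; exists a => //.
rewrite inE; apply/connectP; exists p => //; apply: path_avoid.
- exact: path_adj ap.
- by rewrite inE eq_sym adj_neq.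
- move=> y yp; rewrite inE; apply: contraNneq v_p => <-.
  by rewrite inE yp orbT.
Qed.

Lemma comp_child_sub X a c : X \subset nbrs a -> c \in nbrs a :\: X ->
  comp [set a] c \subset comp X a.
Proof.
move=> /subsetP XN; rewrite !inE => /andP[cX ac].
have aX : a \notin X by apply/negP => /XN; rewrite inE adj_irrefl.
apply: subset_trans (comp_trans (comp_step ac aX cX)); apply: comp_sub => y yc.
apply/negP=> yX; have := XN _ yX; rewrite inE => ay.
by case: T => _ /(_ a c y ac ay yc) cy; rewrite cy yX in cX.
Qed.

Lemma comp_peel X a c : X \subset nbrs a -> c \in nbrs a :\: X ->
  comp X a = comp (c |: X) a :|: comp [set a] c /\
  [disjoint comp (c |: X) a & comp [set a] c].
Proof.
move=> XN cN; have := cN; rewrite !inE => /andP[cX ac]; split; last first.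
  rewrite disjoint_subset; apply/subsetP=> x xa; rewrite inE.
  apply: comp_edge_disj => //.
  by apply: (subsetP (comp_subW _ _)) xa; rewrite sub1set setU11.
apply/setP=> x; rewrite in_setU; apply/idP/orP.
  by move=> xX; apply: comp_through => //; rewrite eq_sym adj_neq.
case; first by apply: (subsetP (comp_subW _ _)); apply: subsetUr.
exact: (subsetP (comp_child_sub XN cN)).
Qed.

Lemma comp_nbrs a : comp (nbrs a) a = [set a].
Proof.
apply/setP=> x; rewrite in_set1; apply/idP/eqP=> [|->]; last exact: mem_comp_root.
case/compP=> [[|c p]] [/= ap <- _] //.
by case/andP: ap => /and3P[ac _]; rewrite inE ac.
Qed.

End Paths.

(** * Subtrees as connected vertex sets *)

Section Subtrees.
Variable G : sgraph.
Implicit Types (a b c u v x y z : G) (X Y S : {set G}).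

(** These are the vertex sets of the subtrees that contain [a] and avoid [X]; connectedness means
    that every member is reached from [a] without meeting the complement. *)
Definition conn_sets a X :=
  [set S : {set G} | [&& a \in S, S \subset ~: X & S \subset comp (~: S) a]].

Hypothesis T : arboreal G.

Lemma conn_sets_sub a X S : S \in conn_sets a X -> S \subset comp X a.
Proof.
rewrite inE => /and3P[aS dSX SC].
by apply: (subset_trans SC (comp_subW _ _)); rewrite subsetC.
Qed.

Lemma conn_sets_restrict S a c X : adj a c -> a \in S -> S \subset ~: X ->
  S \subset comp (~: S) a ->
  S :&: comp [set c] a \in conn_sets a (c |: X).
Proof.
move=> ac aS dSX SC; rewrite inE in_setI aS mem_comp_root /=; apply/andP; split.
  rewrite setCU subsetI (subset_trans _ dSX) ?subsetIl // andbT.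
  apply/subsetP=> x /setIP[_ xC]; rewrite in_setC1.
  by apply: contraTneq xC => ->; apply: comp_opp_notin.
apply/subsetP=> x /setIP[xS xC].
have : x \in comp (c |: ~: S) a.
  case: (comp_through (subsetP SC x xS) (_ : c != a)) => //.
    by rewrite eq_sym adj_neq.
  by move=> xc; have := comp_edge_disj T ac xC; rewrite xc.
apply: subsetP; apply: comp_sub => y ya; rewrite in_setC negbK in_setI.
apply/andP; split.
  have [->//|ya'] := eqVneq y a.
  by have := comp_notin ya ya'; rewrite !inE negb_or negbK => /andP[].
by apply: (subsetP (comp_subW _ _)) ya; rewrite sub1set setU11.
Qed.

Lemma conn_sets_glue S1 S2 a c X : X \subset nbrs a -> c \in nbrs a :\: X ->
  S1 \in conn_sets a (c |: X) -> S2 \in conn_sets c [set a] ->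
  S1 :|: S2 \in conn_sets a X.
Proof.
move=> XN cN h1 h2; have := cN; rewrite !inE => /andP[cX ac].
have sub2 := conn_sets_sub h2.
move: h1 h2; rewrite !inE => /and3P[aS1 d1 c1] /and3P[cS2 d2 c2].
rewrite aS1 /=; apply/andP; split.
  rewrite subUset; apply/andP; split.
    by apply: subset_trans d1 _; rewrite setCS subsetUr.
  apply/subsetP=> x /(subsetP sub2) xc; rewrite in_setC.
  apply/negP=> /[dup] xX /(subsetP XN); rewrite inE => ax.
  by case: T => _ /(_ a c x ac ax xc) cx; rewrite cx xX in cX.
have cC : c \in comp (~: (S1 :|: S2)) a.
  by apply: comp_step => //; rewrite !inE ?aS1 ?cS2 ?orbT.
rewrite subUset; apply/andP; split.
  by apply: subset_trans c1 (comp_subW _ _); rewrite setCS subsetUl.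
apply: subset_trans (comp_trans cC).
by apply: subset_trans c2 (comp_subW _ _); rewrite setCS subsetUr.
Qed.

Lemma conn_sets_root_change S a c X : a \in S -> c \in S ->
  S \subset ~: X -> S \subset comp (~: S) a -> S \in conn_sets c X.
Proof.
move=> aS cS SX SC; rewrite inE cS SX; apply: (subset_trans SC (comp_trans _)).
by rewrite inE avoid_sym; have := subsetP SC c cS; rewrite inE.
Qed.

(** A set either misses [c], or is cut by the edge between [a] and [c] into two connected sets that
    determine it. This is the recursion for the values, one child at a time. *)
Lemma conn_sets_peel a c X : X \subset nbrs a -> c \in nbrs a :\: X ->
  #|conn_sets a X| =
    #|conn_sets a (c |: X)| * #|conn_sets c [set a]|.+1.
Proof.
move=> XN cN; have := cN; rewrite !inE => /andP[cX ac].
have ca : adj c a by rewrite adj_sym.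
rewrite mulnS -cardsX -(cardsID [set S : {set G} | c \notin S]); congr addn.
  apply: eq_card => S; rewrite !inE setCU subsetI.
  rewrite [_ \subset ~: [set c]]subsetC !sub1set !inE.
  by case: (c \in S); rewrite ?andbF ?andbT.
rewrite -(card_in_imset (f := fun p : {set G} * {set G} => p.1 :|: p.2)).
  apply: eq_card => S; apply/setDP/imsetP=> [[SC]|[[S1 S2]]]; last first.
    case/setXP=> h1 h2 ->; split; first exact: (conn_sets_glue XN cN).
    by move: h2; rewrite !inE negbK => /and3P[->]; rewrite orbT.
  rewrite inE negbK => cS; have := SC; rewrite inE => /and3P[aS SX Sa].
  exists (S :&: comp [set c] a, S :&: comp [set a] c); last first.
    by rewrite -setIUr (comp_edgeC T ac) setUCr setIT.
  rewrite inE conn_sets_restrict //=.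
  have := conn_sets_root_change aS cS (_ : S \subset ~: set0) Sa.
  rewrite setC0 subsetT => /(_ isT); rewrite inE => /and3P[_ S0 Sc].
  by have := conn_sets_restrict ca cS S0 Sc; rewrite setU0.
move=> [S1 S2] [S1' S2'] /setXP[h1 h2] /setXP[h1' h2'] /= eqS.
have part U1 U2 : U1 \in conn_sets a (c |: X) -> U2 \in conn_sets c [set a] ->
    U1 = (U1 :|: U2) :&: comp [set c] a /\ U2 = (U1 :|: U2) :&: comp [set a] c.
  move=> /conn_sets_sub U1a /conn_sets_sub U2c.
  have {}U1a : U1 \subset comp [set c] a.
    by apply: subset_trans U1a (comp_subW _ _); rewrite sub1set setU11.
  rewrite !setIUl (setIidPl U1a) (setIidPl U2c) (comp_edgeC T ac).
  move: U2c; rewrite (comp_edgeC T ac) -setDE => U2c.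
  have -> : U1 :\: comp [set c] a = set0 by apply/eqP; rewrite setD_eq0.
  have -> : U2 :&: comp [set c] a = set0.
    by apply/eqP; rewrite setI_eq0 disjoints_subset.
  by rewrite setU0 set0U.
have [e1 e2] := part _ _ h1 h2; have [e1' e2'] := part _ _ h1' h2'.
by congr pair; [rewrite e1 e1' eqS | rewrite e2 e2' eqS].
Qed.

Lemma conn_sets_nbrs a : conn_sets a (nbrs a) = [set [set a]].
Proof.
apply/setP=> S; rewrite [RHS]inE; apply/idP/eqP=> [|->].
  move=> /[dup] /conn_sets_sub; rewrite comp_nbrs => Sa.
  by rewrite inE => /and3P[aS _ _]; apply/eqP; rewrite eqEsubset Sa sub1set.
by rewrite inE !sub1set set11 mem_comp_root !inE adj_irrefl.
Qed.

Lemma edgeE x y : ([set x; y] \in edges G) = adj x y.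
Proof.
rewrite inE; apply/existsP/idP => [[s /existsP[t /andP[st /eqP eqst]]]|xy]; last first.
  by exists x; apply/existsP; exists y; rewrite xy eqxx.
have : s \in [set x; y] by rewrite eqst set21.
have : t \in [set x; y] by rewrite eqst set22.
rewrite !inE => /orP[]/eqP tE /orP[]/eqP sE; move: st; rewrite tE sE ?adj_irrefl //.
by rewrite adj_sym.
Qed.

(** A simple path in [H] from [x] to [y] must leave [x] through [y], because [x] separates its
    neighbours. Hence a subtree is induced by its vertex set, and counting subtrees amounts to
    counting connected sets. *)
Lemma subtree_edge (H : {set G} * {set {set G}}) x y : subtree H ->
  adj x y -> x \in H.1 -> y \in H.1 -> [set x; y] \in H.2.
Proof.
case/and3P=> /andP[/subsetP HE _] _ /forall_inP Hc xy xH yH.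
have := forall_inP (Hc x xH) y yH; case/connectP=> p xp yE.
have subE : subrel (subadj H) (@adj G) by move=> u v /HE; rewrite edgeE.
case/shortenP: xp yE => [[|z q]] /= xq uq _ yE; first by rewrite yE adj_irrefl in xy.
case/andP: xq => xz zq; case/andP: uq => x_q _; have xz' := subE _ _ xz.
suff yz : y \in comp [set x] z.
  by case: T => _ /(_ x z y xz' xy yz) <-.
rewrite inE; apply/connectP; exists q => //; apply: path_avoid.
- exact: sub_path subE _ _ zq.
- by rewrite inE eq_sym adj_neq.
- by move=> u uq; rewrite inE; apply: contraNneq x_q => <-; rewrite inE uq orbT.
Qed.

Definition inner_edges S := [set e in edges G | e \subset S].

Lemma subtree_inner_edges (H : {set G} * {set {set G}}) : subtree H ->
  H.2 = inner_edges H.1.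
Proof.
move=> Hs; have /and3P[/andP[/subsetP HE /bigcupsP Hcov] _ _] := Hs.
apply/setP=> e; rewrite inE; apply/idP/andP => [eH|[]].
  by split; [exact: HE|exact: Hcov].
rewrite inE => /existsP[x /existsP[y /andP[xy /eqP->]]].
by rewrite subUset !sub1set => /andP[]; apply: subtree_edge.
Qed.

Lemma conn_set_subtree a S : S \in conn_sets a set0 -> subtree (S, inner_edges S).
Proof.
rewrite inE => /and3P[aS _ Sa]; apply/and3P; split.
- apply/andP; split; first by apply/subsetP=> e; rewrite inE => /andP[].
  by apply/bigcupsP=> e; rewrite inE => /andP[].
- by apply/set0Pn; exists a.
have sub x y : connect (avoid (~: S)) x y -> connect (subadj (S, inner_edges S)) x y.
  apply: connect_sub => u v /and3P[uv]; rewrite !in_setC !negbK => uS vS.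
  by apply: connect1; rewrite /subadj inE edgeE uv subUset !sub1set uS.
apply/forall_inP=> x xS; apply/forall_inP=> y yS; apply: sub.
have := subsetP Sa x xS; have := subsetP Sa y yS; rewrite !inE => ay ax.
by apply: connect_trans ay; rewrite avoid_sym.
Qed.

Lemma subtree_conn_set (H : {set G} * {set {set G}}) a : subtree H ->
  a \in H.1 -> H.1 \in conn_sets a set0.
Proof.
move=> Hs aH; have /and3P[/andP[/subsetP HE Hcov] _ /forall_inP Hc] := Hs.
rewrite inE aH setC0 subsetT; apply/subsetP=> x xH; rewrite inE.
apply: connect_sub (forall_inP (Hc a aH) x xH) => u v uv; apply: connect1.
have sub : [set u; v] \subset H.1 by apply: (bigcupsP Hcov).
move: uv => /HE; rewrite edgeE /avoid !in_setC !negbK => ->.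
by move: sub; rewrite subUset !sub1set.
Qed.

Lemma nsubtreesE a : nsubtrees a = #|conn_sets a set0|.
Proof.
rewrite /nsubtrees -(card_in_imset (f := fst)).
  apply: eq_card => S; apply/imsetP/idP => [[H]|Sa].
    by rewrite inE => /andP[Hs aH] ->; apply: subtree_conn_set.
  exists (S, inner_edges S) => //; rewrite inE (conn_set_subtree Sa) /=.
  by move: Sa; rewrite inE => /andP[].
move=> [S E] [S' E']; rewrite !inE => /andP[/subtree_inner_edges/= -> _].
by move=> /andP[/subtree_inner_edges/= -> _] ->.
Qed.

(* Every vertex of S other than the root a is matched with the edge towards a. *)
Lemma card_inner_edges a S : S \in conn_sets a set0 -> #|inner_edges S| = #|S|.-1.
Proof.
rewrite inE => /and3P[aS _ /subsetP Sa].
rewrite (cardsD1 a S) aS /=.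
pose up x := odflt x [pick y | adj x y && (a \in comp [set x] y)].
have upP x : x != a -> adj x (up x) /\ a \in comp [set x] (up x).
  move=> xa; rewrite /up; case: pickP => [y /andP[] //|no].
  have [|y xy ay] := comp_nbr_exists T (_ : a != x); first by rewrite eq_sym.
  by have := no y; rewrite xy ay.
have upE x y : x != a -> adj x y -> a \in comp [set x] y -> y = up x.
  move=> xa xy ay; have [xu au] := upP x xa.
  exact: (comp_nbr_inj T xy xu ay au).
rewrite -(card_in_imset (f := fun x => [set x; up x])).
  apply: eq_card => e; apply/idP/imsetP => [|[x /setD1P[xa xS] ->]].
    rewrite inE => /andP[]; rewrite inE => /existsP[x /existsP[y /andP[xy /eqP->]]].
    rewrite subUset !sub1set => /andP[xS yS].
    have yx : adj y x by rewrite adj_sym.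
    have [ax|ay] := orP (comp_edgeT T a xy).
      have ya : y != a by apply: contraTneq ax => <-; apply: comp_opp_notin.
      by exists y; rewrite ?inE ?ya // setUC (upE y x).
    have xa : x != a by apply: contraTneq ay => <-; apply: comp_opp_notin.
    by exists x; rewrite ?inE ?xa // (upE x y).
  have [xu au] := upP x xa; rewrite inE edgeE xu subUset !sub1set xS /=.
  have [p [ap lp up_]] := compP (Sa x xS).
  case/lastP: p ap lp up_ => [|p y] ap lp up_; first by rewrite -lp /= eqxx in xa.
  rewrite last_rcons in lp; rewrite lp in ap up_.
  move: (ap); rewrite rcons_path => /andP[ap' /and3P[ux _]].
  rewrite in_setC negbK => _.
  have lS : last a p \in S.
    by move: ap; rewrite rcons_path => /andP[_ /and3P[_]]; rewrite in_setC negbK.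
  rewrite -(upE x (last a p)) // 1?adj_sym //.
  rewrite inE avoid_sym; apply/connectP; exists p => //; apply: path_avoid.
  - exact: path_adj ap'.
  - by rewrite inE eq_sym.
  - move=> y' yp; rewrite inE; apply: contraTneq up_ => <-.
    by rewrite -rcons_cons rcons_uniq inE yp orbT.
move=> x y /setD1P[xa _] /setD1P[ya _] eqxy.
have [xu au] := upP x xa; have [yu av] := upP y ya.
have : x \in [set y; up y] by rewrite -eqxy set21.
rewrite !inE => /orP[/eqP//|/eqP xE].
have : y \in [set x; up x] by rewrite eqxy set21.
rewrite !inE => /orP[/eqP//|/eqP yE].
rewrite -yE in xu au; rewrite -xE in yu av.
by have := comp_edge_disj T xu av; rewrite au.
Qed.

End Subtrees.

(** * Centroid, subtree core and shapes *)

Section Weight.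
Variable G : sgraph.
Implicit Types (a b c u v x y z : G) (X Y S : {set G}).
Hypothesis T : arboreal G.

Lemma comp_card a b : adj a b ->
  #|comp [set b] a| + #|comp [set a] b| = #|G|.
Proof. by move=> ab; rewrite (comp_edgeC T ab) cardsC. Qed.

Lemma comp_proper a b c : adj b a -> adj a c -> c != b ->
  #|comp [set a] c| < #|comp [set b] a|.
Proof.
move=> ba ac cb; apply/proper_card/properP; split.
  by apply: comp_child_sub => //; rewrite ?sub1set !inE ?cb // adj_sym.
by exists a; rewrite ?mem_comp_root ?comp_opp_notin // adj_sym.
Qed.

(** The single edge of [K] at [v] is the first step of every simple path in [K] from [v], so [K]
    meets only one component of the graph without [v]. *)
Lemma pendant_subtree (K : {set G} * {set {set G}}) v :
  subtree K -> pendant_in K v ->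
  exists a, [/\ adj v a, a \in K.1, [set v; a] \in K.2 &
    K.1 \subset v |: comp [set v] a].
Proof.
move=> Ks /andP[vK /cards1P[e eE]].
have /and3P[/andP[/subsetP HE Hcov] _ _] := Ks.
have /setIdP[eK ve] : e \in [set e in K.2 | v \in e] by rewrite eE set11.
have [a eva] : exists a, e = [set v; a].
  have := HE e eK; rewrite inE => /existsP[x /existsP[y /andP[_ /eqP eqe]]].
  move: ve; rewrite eqe !inE => /orP[]/eqP->; first by exists y.
  by exists x; rewrite setUC.
have va : adj v a by rewrite -edgeE -eva HE.
exists a; split=> //; [|by rewrite -eva|].
  by apply: (subsetP (bigcupsP Hcov e eK)); rewrite eva set22.
apply/subsetP=> x xK; rewrite in_setU1; have [//|xv] := eqVneq x v.
have := subtree_conn_set Ks vK; rewrite inE => /and3P[_ _ /subsetP/(_ x xK)].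
case/compP=> [[|c p]] [vp lx up]; first by rewrite -lx eqxx in xv.
have cK : c \in K.1.
  by have := path_avoid_notin vp (mem_head c p); rewrite in_setC negbK.
case/andP: vp => /and3P[vc _ _] cp.
have : [set v; c] \in [set e in K.2 | v \in e].
  by rewrite inE set21 andbT; apply: subtree_edge.
rewrite eE inE eva => /eqP eqc.
have ca : c = a.
  have : c \in [set v; a] by rewrite -eqc set22.
  by rewrite !inE eq_sym (negbTE (adj_neq vc)) => /eqP.
rewrite /= inE -ca; apply/connectP; exists p => //; apply: path_avoid.
- exact: path_adj cp.
- by rewrite inE eq_sym adj_neq.
- case/andP: up => v_p _ y yp; rewrite inE; apply: contraNneq v_p => <-.
  by rewrite inE yp orbT.
Qed.

Lemma branch_conn_set v a : adj v a ->
  v |: comp [set v] a \in conn_sets v set0.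
Proof.
move=> va; rewrite inE setU11 setC0 subsetT /= subUset sub1set mem_comp_root /=.
have aC : a \in comp (~: (v |: comp [set v] a)) v.
  by apply: comp_step; rewrite ?in_setC ?negbK ?in_setU1 ?eqxx ?mem_comp_root ?orbT.
apply: subset_trans (comp_trans aC); apply: comp_sub => y ya.
by rewrite in_setC negbK in_setU1 ya orbT.
Qed.

(** The vertex [v] and the component of [a] span a branch, which has one edge per vertex of the
    component. Together with the next lemma, [weight v] is the largest size of a component left by
    the removal of [v]. *)
Lemma weight_ge v a : adj v a -> #|comp [set v] a| <= weight v.
Proof.
move=> va; set S := v |: comp [set v] a.
have Sc := branch_conn_set va; rewrite -/S in Sc.
have vS : v \in S by rewrite setU11.
have vC : v \notin comp [set v] a by rewrite comp_opp_notin // adj_sym.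
have cardS : #|inner_edges S| = #|comp [set v] a|.
  by rewrite (card_inner_edges T Sc) cardsU1 vC.
have Ss := conn_set_subtree Sc.
rewrite -cardS -[inner_edges S]/((S, inner_edges S).2); apply: leq_bigmax_cond.
apply/and3P; split=> //.
  rewrite /pendant_in /= vS /=; apply/cards1P; exists [set v; a].
  apply/setP=> e; rewrite !inE; apply/idP/eqP => [|->]; last first.
    rewrite set21 andbT; have := edgeE v a; rewrite inE va => -> /=.
    by rewrite subUset !sub1set vS in_setU1 mem_comp_root orbT.
  case/andP=> /andP[/existsP[x /existsP[y /andP[xy /eqP eqe]]]].
  have main b : adj v b -> b \in S -> b = a.
    move=> vb; rewrite in_setU1 => /predU1P[bv|ba].
      by rewrite bv adj_irrefl in vb.
    exact: (comp_nbr_inj T vb va (mem_comp_root _ _) ba).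
  rewrite eqe subUset !sub1set => /andP[xS yS] /set2P[] vE.
    by rewrite vE -(main y) // -?vE // vE.
  by rewrite vE setUC -(main x) // -?vE // vE adj_sym.
apply/forallP=> K; apply/implyP=> /and3P[Ks Kv /andP[/= SK EK]].
have [b [vb bK _ Kb]] := pendant_subtree Ks Kv.
have ab : a = b.
  have : a \in K.1 by apply: (subsetP SK); rewrite in_setU1 mem_comp_root orbT.
  move=> /(subsetP Kb); rewrite in_setU1 => /predU1P[av|].
    by rewrite av adj_irrefl in va.
  by move=> ab; apply: (comp_nbr_inj T va vb (mem_comp_root _ _) ab).
have KS : K.1 = S by apply/eqP; rewrite eqEsubset SK /S ab Kb.
by case: K KS Ks {SK EK Kv bK Kb} => K1 K2 /= -> /subtree_inner_edges/= ->.
Qed.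

Lemma weight_le v m : (forall a, adj v a -> #|comp [set v] a| <= m) -> weight v <= m.
Proof.
move=> le_m; apply/bigmax_leqP => K /and3P[Ks Kv _].
have [a [va aK _ Ka]] := pendant_subtree Ks Kv; apply: leq_trans (le_m a va).
have /andP[vK _] := Kv.
rewrite (subtree_inner_edges T Ks) (card_inner_edges T (subtree_conn_set Ks vK)).
have vC : v \notin comp [set v] a by rewrite comp_opp_notin // adj_sym.
by have := subset_leq_card Ka; rewrite cardsU1 vC; case: #|K.1|.
Qed.

(** If the side of [v] were at least as large, it would bound every branch at [v], and it is itself
    bounded by [weight u]; so [weight v <= weight u]. *)
Lemma centroid_step u v : adj u v -> u \in centroid G -> v \notin centroid G ->
  #|comp [set u] v| < #|comp [set v] u|.
Proof.
move=> uv; rewrite !inE => /forallP uC; rewrite negb_forall => /existsP[y].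
rewrite -ltnNge => lt_y; have {lt_y} lt_uv := leq_ltn_trans (uC y) lt_y.
have vu : adj v u by rewrite adj_sym.
rewrite ltnNge; apply/negP=> le_uv; move: lt_uv; rewrite ltnNge => /negP[].
apply: weight_le => a va; have [->|au] := eqVneq a u.
  exact: leq_trans le_uv (weight_ge uv).
exact: leq_trans (ltnW (comp_proper uv va au)) (weight_ge uv).
Qed.

(** Seen from [y] outside the heavy side, that whole side lies in one component, so [weight y] is at
    least its size. But [weight z] is smaller: the branch towards [z'] is light, and the others are
    proper parts of the heavy side. *)
Lemma centroid_sub z z' : adj z' z ->
  #|comp [set z] z'| < #|comp [set z'] z| -> centroid G \subset comp [set z'] z.
Proof.
move=> z'z lt_z; have zz' : adj z z' by rewrite adj_sym.
apply/subsetP=> y; apply: contraLR => yC; rewrite inE negb_forall.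
apply/existsP; exists z; rewrite -ltnNge.
have le_y : #|comp [set z'] z| <= weight y.
  have zy : z != y by apply: contraNneq yC => <-; apply: mem_comp_root.
  have [a ya za] := comp_nbr_exists T zy.
  apply: leq_trans (weight_ge ya); apply: subset_leq_card.
  apply: subset_trans (comp_trans za); apply: comp_sub => x xC.
  by rewrite inE; apply: contraNneq yC => <-.
apply: leq_trans le_y.
have lt_a a : adj z a -> #|comp [set z] a| < #|comp [set z'] z|.
  by move=> za; have [->//|] := eqVneq a z'; apply: comp_proper.
have z_gt0 := leq_ltn_trans (leq0n _) lt_z.
rewrite -(prednK z_gt0) ltnS; apply: weight_le => a za.
by rewrite -ltnS (prednK z_gt0) lt_a.
Qed.

Lemma nsubtrees_edge a b : adj a b ->
  nsubtrees a = #|conn_sets a [set b]| * #|conn_sets b [set a]|.+1.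
Proof.
move=> ab; rewrite nsubtreesE // (@conn_sets_peel _ T a b) ?sub0set ?setU0 //.
by rewrite !inE.
Qed.

(** With [A] and [B] the counts on the two sides, the ends of the edge lie in [A * (1 + B)] and
    [B * (1 + A)] subtrees; these differ by [A - B]. *)
Lemma core_step w x : adj w x -> w \in subtree_core G -> x \notin subtree_core G ->
  #|conn_sets x [set w]| < #|conn_sets w [set x]|.
Proof.
move=> wx; rewrite !inE => /forallP wC; rewrite negb_forall => /existsP[y].
rewrite -ltnNge => lt_y; have {lt_y} := leq_trans lt_y (wC y).
rewrite (nsubtrees_edge wx) (@nsubtrees_edge x w) 1?adj_sym //.
by rewrite !mulnS [X in _ + X < _]mulnC ltn_add2r.
Qed.

(** The part of the graph reached from [a] while avoiding [X] has shape [t] with root [a]. Here [X]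
    holds the parent of [a], or nothing at the top; the order of the two children is arbitrary. *)
Inductive hang : {set G} -> G -> btree -> Prop :=
| HangLeaf X a : nbrs a \subset X -> hang X a Leaf
| HangNode X a c d t1 t2 : c != d -> nbrs a :\: X = [set c; d] ->
    hang [set a] c t1 -> hang [set a] d t2 -> hang X a (Node t1 t2).

Lemma hang_node_children X y t1 t2 : hang X y (Node t1 t2) ->
  exists c d, [/\ c != d, nbrs y :\: X = [set c; d],
    hang [set y] c t1 & hang [set y] d t2].
Proof.
move: {-2}(Node t1 t2) (erefl (Node t1 t2)) => t tE ht; case: ht tE => //.
by move=> {X y t}X y c d u1 u2 cd eN h1 h2 [<- <-]; exists c, d.
Qed.

Lemma set2D_adj X y c d : nbrs y :\: X = [set c; d] ->
  [/\ adj y c, adj y d, c \notin X & d \notin X].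
Proof.
move=> eN; have : c \in nbrs y :\: X by rewrite eN set21.
have : d \in nbrs y :\: X by rewrite eN set22.
by rewrite !inE => /andP[-> ->] /andP[-> ->].
Qed.

Lemma hang_card X a t : hang X a t -> X \subset nbrs a ->
  #|conn_sets a X| = root_subtrees t /\ #|comp X a| = (leaves t).*2.-1.
Proof.
elim=> {X a t} [X a aX|X a c d t1 t2 cd eN _ IH1 _ IH2] XN.
  have -> : X = nbrs a by apply/eqP; rewrite eqEsubset XN.
  by rewrite conn_sets_nbrs // comp_nbrs !cards1.
have cN : c \in nbrs a :\: X by rewrite eN set21.
have dN : d \in nbrs a :\: (c |: X).
  have : d \in nbrs a :\: X by rewrite eN set22.
  by rewrite !inE => /andP[dX ad]; rewrite negb_or eq_sym cd dX ad.
have cXN : c |: X \subset nbrs a.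
  by rewrite subUset sub1set XN andbT; move: cN; rewrite inE => /andP[].
have NE : d |: (c |: X) = nbrs a.
  apply/setP=> y; rewrite !in_setU1.
  have : (y \in nbrs a :\: X) = (y \in [set c; d]) by rewrite eN.
  rewrite in_setD in_set2 => yE; have [yX|yX] := boolP (y \in X).
    by rewrite !orbT (subsetP XN).
  by rewrite yX /= in yE; rewrite yE orbF orbC.
have [ac ad] : adj a c /\ adj a d.
  by move: cN dN; rewrite !inE => /andP[_ ->] /andP[_ ->].
have [|M1 C1] := IH1; first by rewrite sub1set inE adj_sym.
have [|M2 C2] := IH2; first by rewrite sub1set inE adj_sym.
rewrite (conn_sets_peel T XN cN) (conn_sets_peel T cXN dN) NE conn_sets_nbrs //.
have [-> dis1] := comp_peel T XN cN; have [e2 dis2] := comp_peel T cXN dN.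
rewrite e2 NE comp_nbrs in dis1 dis2 *.
have cardU (A B : {set G}) : [disjoint A & B] -> #|A :|: B| = #|A| + #|B|.
  by move=> /disjoint_setI0 AB; rewrite cardsU AB cards0 subn0.
rewrite !cardU // !cards1 M1 M2 C1 C2 mul1n mulnC; split=> //=.
by have := leaves_gt0 t1; have := leaves_gt0 t2; clear; lia.
Qed.

Lemma hang_exists X a : X \subset nbrs a ->
  #|nbrs a :\: X| = 0 \/ #|nbrs a :\: X| = 2 ->
  (forall v, v \in comp X a -> v != a -> deg v = 1 \/ deg v = 3) ->
  exists t, hang X a t.
Proof.
have [n] := ubnP #|comp X a|; elim: n X a => // n IH X a ltn XN [|] cN degP.
  by exists Leaf; apply: HangLeaf; rewrite -setD_eq0 -cards_eq0 cN.
have /cards2P[c [d [cd eN]]] := introT eqP cN.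
have sub e : e \in nbrs a :\: X -> exists t, hang [set a] e t.
  move=> eNX; have sub := comp_child_sub T XN eNX.
  have ae : adj a e by move: eNX; rewrite !inE => /andP[].
  have ea : a \in nbrs e by rewrite inE adj_sym.
  have neq_a v : v \in comp [set a] e -> v != a.
    by apply: contraTneq => ->; rewrite comp_opp_notin // adj_sym.
  apply: IH; rewrite ?sub1set //.
  - apply: (@leq_trans #|comp X a|) => //.
    apply: proper_card; apply/properP; split=> //.
    exists a; first exact: mem_comp_root.
    by apply/negP=> /neq_a; rewrite eqxx.
  - have := cardsD1 a (nbrs e); rewrite ea -/(deg e) => degE.
    have := degP e (subsetP sub e (mem_comp_root _ _)) (neq_a e (mem_comp_root _ _)).
    by rewrite degE; lia.
  - move=> v vC ve; apply: degP; first exact: (subsetP sub).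
    exact: neq_a.
have [|t1 h1] := sub c; first by rewrite eN set21.
have [|t2 h2] := sub d; first by rewrite eN set22.
by exists (Node t1 t2); apply: HangNode h1 h2.
Qed.

End Weight.

(** * Distance levels *)

Section Distance.
Variable G : sgraph.
Implicit Types (a b c u v x y z r : G) (X Y S : {set G}) (p : seq G).

Lemma dist_le x p : path (@adj G) x p -> dist x (last x p) <= size p.
Proof.
move=> xp; rewrite /dist; set P := (X in find X).
have [lt_p|] := ltnP (size p) #|G|; last first.
  by move=> le; apply: leq_trans le; rewrite -[leqRHS](size_iota 0) find_size.
rewrite leqNgt; apply/negP=> lt_find.
have := before_find 0 lt_find; rewrite nth_iota // add0n /P => /negbT/negP[].
by apply/existsP; exists (in_tuple p); rewrite xp eqxx.
Qed.

Lemma dist_path x y : connect (@adj G) x y ->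
  exists p, [/\ path (@adj G) x p, last x p = y & size p = dist x y].
Proof.
case/connectP=> p0 xp0 ->; case/shortenP: xp0 => p xp up _.
rewrite /dist; set P := (X in find X).
have hasP : has P (iota 0 #|G|).
  apply/hasP; exists (size p); last first.
    by rewrite /P; apply/existsP; exists (in_tuple p); rewrite xp eqxx.
  by rewrite mem_iota /= add0n -[(size p).+1]/(size (x :: p)) -(card_uniqP up) max_card.
have := nth_find 0 hasP; rewrite nth_iota; last first.
  by rewrite -{2}[#|G|](size_iota 0) -has_find.
rewrite add0n {1}/P; case/existsP=> q /andP[xq /eqP lq]; exists q; split=> //.
by rewrite size_tuple.
Qed.

Lemma dist_refl x : dist x x = 0.
Proof. by apply/eqP; rewrite -leqn0 (@dist_le x [::]). Qed.

(** A certificate that the graph is a tree and that [dep] is the distance from [r]. In a given tree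
    [dist r] satisfies it; for breadth-first numbered and glued trees an explicit [dep] yields both
    acyclicity and the distances. *)
Definition layered r (dep : G -> nat) := [/\ dep r = 0,
  forall x, x != r -> exists2 y, adj x y & dep x = (dep y).+1,
  forall x y z, adj x y -> adj x z -> dep y <= dep x -> dep z <= dep x -> y = z &
  forall x, adj r x -> 0 < dep x].

Section Layered.
Variables (r : G) (dep : G -> nat).
Hypothesis L : layered r dep.

Lemma layered_adj x y : adj x y -> dep x = (dep y).+1 \/ dep y = (dep x).+1.
Proof.
have [r0 up uniq_up r1] := L; wlog le : x y / dep y <= dep x.
  move=> H xy; case: (leqP (dep y) (dep x)) => [|/ltnW] le; first exact: H.
  by have [|||] := H y x; rewrite 1?adj_sym //; [right|left].
move=> xy; have xr : x != r.
  by apply: contraTneq le => xr; rewrite xr r0 -ltnNge r1 // -xr.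
have [z xz xzE] := up x xr; left; rewrite xzE.
by rewrite (uniq_up x y z) // xzE.
Qed.

Lemma layered_connect x : connect (@adj G) r x.
Proof.
have [r0 up _ _] := L; have [n] := ubnP (dep x); elim: n x => // n IH x.
have [->//|xr] := eqVneq x r; have [y xy ->] := up x xr => ltn.
by apply: connect_trans (IH y ltn) (connect1 _); rewrite adj_sym.
Qed.

Lemma layered_dist x : dist r x = dep x.
Proof.
have [r0 up _ _] := L; apply/eqP; rewrite eqn_leq; apply/andP; split.
  suff [p [rp <- <-]] : exists p, [/\ path (@adj G) r p, last r p = x & size p = dep x].
    exact: dist_le.
  have [n] := ubnP (dep x); elim: n x => // n IH x.
  have [->|xr] := eqVneq x r; first by exists [::]; rewrite r0.
  have [y xy ->] := up x xr => /IH[p [rp lp sp]].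
  by exists (rcons p x); rewrite rcons_path rp lp adj_sym xy last_rcons size_rcons sp.
have [p [rp <- <-]] := dist_path (layered_connect x).
elim/last_ind: p rp => [|p y IH]; first by rewrite r0.
rewrite rcons_path last_rcons size_rcons => /andP[/IH le_p /layered_adj].
by lia.
Qed.

(** On a cycle with at least 3 vertices, the two neighbours of a deepest vertex would be distinct
    and not deeper. *)
Lemma layered_tree : tree G.
Proof.
split=> [x y|c /andP[cyc uc]].
  apply: connect_trans (layered_connect y); rewrite sym_connect_sym ?layered_connect //.
  exact: adj_sym.
have [r0 up uniq_up _] := L.
case: c cyc uc => // x0 c0; set c := x0 :: c0 => cyc uc.
have x0c : x0 \in c by rewrite mem_head.
case: (@arg_maxnP _ x0 (mem c) dep x0c) => x xc max_x.
case/rot_to: (xc) => i q eq_q.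
have {}cyc : cycle (@adj G) (x :: q) by rewrite -eq_q rot_cycle.
have {}uc : uniq (x :: q) by rewrite -eq_q rot_uniq.
have szc : size c = size (x :: q) by rewrite -eq_q size_rot.
have memq y : y \in x :: q -> dep y <= dep x by rewrite -eq_q mem_rot => /max_x.
rewrite szc; case: q cyc uc {eq_q szc} memq => [|y q] // cyc uc memq.
case/lastP: q cyc uc memq => [|q z] // cyc uc memq.
move: cyc; rewrite /cycle rcons_path /= last_rcons => /andP[/andP[xy _] zx].
suff yz : y = z by move: uc; rewrite /= yz mem_rcons mem_head andbF.
apply: (uniq_up x); rewrite // 1?adj_sym //; apply: memq.
  by rewrite !inE eqxx orbT.
by rewrite !inE mem_rcons mem_head !orbT.
Qed.

End Layered.

Hypothesis T : arboreal G.

Lemma dist_layered r : layered r (dist r).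
Proof.
have [conn _] := T.
(* A shortest path from [r] to [y] cannot pass through [x], which is no closer to [r] than [y]. *)
have near x y : adj x y -> dist r y <= dist r x -> r \in comp [set x] y.
  move=> xy le_yx; have [p [rp lp sp]] := dist_path (conn r y).
  have x_p : x \notin r :: p.
    rewrite inE negb_or; apply/andP; split.
      apply: contraTneq xy => xr; move: le_yx; rewrite xr dist_refl leqn0 -sp.
      by case: p lp {rp sp} => //= <- _; rewrite adj_irrefl.
    apply/negP=> /splitPr xp; case: xp rp lp sp => p1 p2.
    rewrite cat_path last_cat size_cat /= => /and3P[rp1 e1 _] lp sp.
    have := @dist_le r (rcons p1 x); rewrite rcons_path rp1 e1 last_rcons size_rcons.
    case: p2 lp sp => [|z p2] /= lp sp; first by rewrite lp adj_irrefl in xy.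
    by move=> /(_ isT); lia.
  move: x_p; rewrite inE negb_or => /andP[xr x_p].
  rewrite inE avoid_sym -lp; apply/connectP; exists p => //.
  apply: path_avoid => //; first by rewrite inE eq_sym.
  by move=> z zp; rewrite inE; apply: contraNneq x_p => <-.
split=> [||x y z xy xz /(near _ _ xy) ry /(near _ _ xz) rz|x rx].
- exact: dist_refl.
- move=> x xr; have [p [rp lp sp]] := dist_path (conn r x).
  case/lastP: p rp lp sp => [|p z] rp lp sp; first by rewrite -lp eqxx in xr.
  rewrite last_rcons in lp; rewrite lp rcons_path in rp; case/andP: rp => rp zx.
  exists (last r p); first by rewrite adj_sym.
  rewrite size_rcons in sp; have := dist_le rp.
  have [q [rq lq sq]] := dist_path (conn r (last r p)).
  have := @dist_le r (rcons q x); rewrite rcons_path rq lq zx last_rcons size_rcons.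
  by move=> /(_ isT); lia.
- exact: (comp_nbr_inj T xy xz ry rz).
- have [p [rp lp <-]] := dist_path (conn r x); case: p rp lp => //= _ xr.
  by rewrite xr adj_irrefl in rx.
Qed.

End Distance.

(** * Shapes of rgood trees *)

Section RgoodShape.
Variables (R : sgraph) (r : R).
Implicit Types (a b c u v x y z p q : R) (X : {set R}).
Hypothesis T : arboreal R.

Notation lv := (dist r).
Notation parent := (@is_parent R r).

Lemma parent_inj p q x : parent p x -> parent q x -> p = q.
Proof.
have [_ _ uniq_up _] := dist_layered T r.
move=> /andP[px /eqP lp] /andP[qx /eqP lq].
by apply: (uniq_up x); rewrite 1?adj_sym //; lia.
Qed.

Definition descendant a x := connect parent a x.

Lemma descendant_last a x : descendant a x ->
  x = a \/ exists2 p, descendant a p & parent p x.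
Proof.
case/connectP=> p ap ->; case/lastP: p ap => [|p y]; first by left.
rewrite rcons_path last_rcons => /andP[ap py]; right; exists (last a p) => //.
by apply/connectP; exists p.
Qed.

Lemma descendant_lv a x : descendant a x -> lv a <= lv x.
Proof.
case/connectP=> p ap ->; elim: p a ap => //= y p IH a /andP[/andP[_ /eqP ly] /IH].
by rewrite ly; apply: ltnW.
Qed.

Lemma descendant_inj u v x : lv u = lv v ->
  descendant u x -> descendant v x -> u = v.
Proof.
move=> luv; have [n] := ubnP (lv x); elim: n x => // n IH x ltn ux vx.
have [xu|[p up px]] := descendant_last ux; have [xv|[q vq qx]] := descendant_last vx.
- by rewrite -xu.
- have := descendant_lv vq; have /andP[_ /eqP] := qx.
  by rewrite xu; lia.
- have := descendant_lv up; have /andP[_ /eqP] := px.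
  by rewrite xv; lia.
- rewrite (parent_inj qx px) in vq; apply: (IH p) => //.
  by have /andP[_ /eqP] := px; lia.
Qed.

(** The comparison is handed from two vertices of one level to their parents until [u] and [v] are
    reached; the parents stay distinct because a vertex has only one ancestor on each level. *)
Lemma descendant_order le u v x y : level_order r le -> 0 < lv u ->
  lv u = lv v -> u != v -> descendant u x -> descendant v y -> lv x = lv y ->
  le x y = le u v.
Proof.
case=> _ ord lu luv uv; have [n] := ubnP (lv x).
elim: n x y => // n IH x y ltn ux vy lxy.
have [xu|[p up px]] := descendant_last ux; have [yv|[q vq qy]] := descendant_last vy.
- by rewrite xu yv.
- have := descendant_lv vq; have /andP[_ /eqP] := qy.
  by rewrite -lxy xu; lia.
- have := descendant_lv up; have /andP[_ /eqP] := px.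
  by rewrite lxy yv; lia.
have /andP[_ /eqP lp] := px; have /andP[_ /eqP lq] := qy.
have ltp := descendant_lv up.
have pq : p != q.
  by apply: contraNneq uv => pq; rewrite -pq in vq; rewrite (descendant_inj luv up vq).
have -> : le x y = le p q.
  by apply: (ord (lv p)) => //; rewrite ?inE -?lxy ?lp //; lia.
by apply: IH => //; lia.
Qed.

Definition hung X a := (a = r /\ X = set0) \/ (exists2 b, parent b a & X = [set b]).

Lemma hung_child X a c : hung X a -> c \in nbrs a :\: X ->
  parent a c /\ hung [set a] c.
Proof.
move=> hX; rewrite !inE => /andP[cX ac].
suff ac' : parent a c by split=> //; right; exists a.
rewrite /is_parent ac /=; have L := dist_layered T r.
have [lac|->//] := layered_adj L ac.
case: hX => [[ar _]|[b /andP[ba /eqP lb] XE]]; first by rewrite ar dist_refl in lac.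
have [_ _ uniq_up _] := L; rewrite XE inE in cX.
by rewrite (uniq_up a c b) ?eqxx ?lac // 1?adj_sym // in cX; lia.
Qed.

Lemma hung_sub X a : hung X a -> X \subset nbrs a.
Proof.
case=> [[_ ->]|[b /andP[ba _] ->]]; first exact: sub0set.
by rewrite sub1set inE adj_sym.
Qed.

Lemma hung_exists x : exists X, hung X x.
Proof.
have [_ up _ _] := dist_layered T r; have [xr|xr] := eqVneq x r.
  by exists set0; left.
have [y xy lx] := up x xr; exists [set y]; right; exists y => //.
by rewrite /is_parent adj_sym xy lx eqxx.
Qed.

Section Order.
Variables (h : nat) (le : rel R).
Hypothesis hh : height r = h.+1.
Hypothesis deg_r : deg r = 2.
Hypothesis flat : forall x y, pendant x -> pendant y -> lv x <= (lv y).+1.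
Hypothesis ord : level_order r le.
Hypothesis final : {in level r h &, forall p q, deepest_parent r p -> le p q ->
  deepest_parent r q}.

Lemma lv_le x : lv x <= h.+1.
Proof. by rewrite -hh /height; apply: leq_bigmax. Qed.

Lemma hang_top X c t : hung X c -> lv c = h.+1 -> hang X c t -> t = Leaf.
Proof.
move=> hX lc ht; case: ht hX lc => // {X t}X a c' d t1 t2 _ eN _ _ hX la.
have [|/andP[_ /eqP lc] _] := @hung_child X a c' hX; first by rewrite eN set21.
by have := lv_le c'; rewrite lc la ltnn.
Qed.

Lemma pendant_top X c : hung X c -> lv c = h.+1 -> pendant c.
Proof.
move=> hX lc; case: (hX) => [[cr _]|[b /andP[bc _] XE]].
  by rewrite cr dist_refl in lc.
suff -> : pendant c = (#|[set b]| == 1) by rewrite cards1.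
rewrite /pendant /deg -/(nbrs c) -XE; congr (_ == 1); apply: eq_card.
apply/subset_eqP; rewrite hung_sub // andbT; apply/subsetP=> d cd.
apply/negPn/negP=> dX; have [|/andP[_ /eqP ld] _] := @hung_child X c d hX.
  by rewrite inE dX.
by have := lv_le d; rewrite ld lc ltnn.
Qed.

(** A pendant vertex above level [h] would differ by at least 2 in height from a pendant vertex at
    level [h.+1]; the root is excluded by its degree. *)
Lemma hang_inner X a t : hung X a -> lv a < h -> hang X a t -> t <> Leaf.
Proof.
move=> hX la ht; case: ht hX la => // {X t}X {}a aX hX la _.
case: (hX) => [[ar X0]|[b /andP[ba _] XE]].
  move: deg_r; rewrite /deg -/(nbrs r) -ar; move: aX.
  by rewrite X0 subset0 => /eqP->; rewrite cards0.
have pa : pendant a.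
  rewrite /pendant /deg -/(nbrs a) (_ : nbrs a = [set b]) ?cards1 //.
  by apply/eqP; rewrite eqEsubset -XE aX hung_sub.
have R_gt0 : 0 < #|R| by apply/card_gt0P; exists r.
have [z lz] := eq_bigmax lv R_gt0; rewrite -/(height r) hh in lz.
have [Z hZ] := hung_exists z.
by have := flat (pendant_top hZ (esym lz)) pa; lia.
Qed.

Definition meets_deepest a :=
  exists2 x, descendant a x & lv x = h /\ deepest_parent r x.
Definition all_deepest a :=
  forall x, descendant a x -> lv x = h -> deepest_parent r x.

Lemma hang_split n X a t : hung X a -> lv a + n.+1 = h -> hang X a t ->
  exists c d t1 t2, [/\ t = Node t1 t2, c != d, parent a c /\ parent a d,
    hung [set a] c /\ hung [set a] d & hang [set a] c t1 /\ hang [set a] d t2].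
Proof.
move=> hX la ht; have lt_a : lv a < h by lia.
have := hang_inner hX lt_a ht; case: ht hX {la lt_a} => //.
move=> {X t}X {}a c d t1 t2 cd eN h1 h2 hX _.
have [|pc hc] := @hung_child X a c hX; first by rewrite eN set21.
have [|pd hd] := @hung_child X a d hX; first by rewrite eN set22.
by exists c, d, t1, t2.
Qed.

Lemma hang_bottom X a t : hung X a -> lv a = h -> hang X a t ->
  t = Leaf /\ ~ deepest_parent r a \/ t = Node Leaf Leaf /\ deepest_parent r a.
Proof.
move=> hX la ht; case: ht hX la => {X t}X {}a.
  move=> aX hX la; left; split=> // /exists_inP[x _ /andP[_ /andP[ax /eqP lx]]].
  have xX : x \in X by apply: (subsetP aX); rewrite inE.
  case: hX xX => [[_ ->]|[b /andP[_ /eqP lb] ->]]; rewrite inE // => /eqP xb.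
  by rewrite xb lb in lx; lia.
move=> c d t1 t2 cd eN h1 h2 hX la; right.
have [|pc hc] := @hung_child X a c hX; first by rewrite eN set21.
have [|pd hd] := @hung_child X a d hX; first by rewrite eN set22.
have /andP[_ /eqP lc] := pc; have /andP[_ /eqP ld] := pd.
rewrite la in lc ld; rewrite (hang_top hc lc h1) (hang_top hd ld h2); split=> //.
apply/exists_inP; exists c; first by rewrite inE lc hh.
by rewrite pc (pendant_top hc lc).
Qed.

Lemma descendant_child a c x : parent a c -> descendant c x -> descendant a x.
Proof. by move=> ac; apply: connect_trans (connect1 ac). Qed.

Lemma hang_shallow n X a t : hung X a -> lv a + n = h -> hang X a t ->
  ~ meets_deepest a -> t = perfect n.
Proof.
elim: n X a t => [|n IH] X a t hX la ht no.
  case: (hang_bottom hX _ ht); first by lia.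
    by case.
  by case=> _ da; case: no; exists a; [apply: connect0|split=> //; lia].
have [c [d [t1 [t2 [-> _ [pc pd] [hc hd] [h1 h2]]]]]] := hang_split hX la ht.
have /andP[_ /eqP lc] := pc; have /andP[_ /eqP ld] := pd.
rewrite (IH _ _ _ hc _ h1) ?(IH _ _ _ hd _ h2) //; try lia.
  by case=> x dx lx; apply: no; exists x => //; apply: descendant_child dx.
by case=> x cx lx; apply: no; exists x => //; apply: descendant_child cx.
Qed.

Lemma hang_deep n X a t : hung X a -> lv a + n = h -> hang X a t ->
  all_deepest a -> t = perfect n.+1.
Proof.
elim: n X a t => [|n IH] X a t hX la ht all_a.
  case: (hang_bottom hX _ ht); first by lia.
    by case=> _ []; apply: all_a; [apply: connect0|lia].
  by case.
have [c [d [t1 [t2 [-> _ [pc pd] [hc hd] [h1 h2]]]]]] := hang_split hX la ht.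
have /andP[_ /eqP lc] := pc; have /andP[_ /eqP ld] := pd.
rewrite (IH _ _ _ hc _ h1) ?(IH _ _ _ hd _ h2) //; try lia.
  by move=> x dx; apply: all_a; apply: descendant_child dx.
by move=> x cx; apply: all_a; apply: descendant_child cx.
Qed.

(** Let the sibling [c] precede [d]. If some descendant of [c] at level [h] has children, all
    descendants of [d] at that level come later and have children by the final segment condition, so
    the shape at [d] is perfect of height [n.+1]. Otherwise the shape at [c] is perfect of height
    [n]. *)
Lemma hang_rg_shape n X a t : hung X a -> lv a + n = h -> hang X a t ->
  rg_shape n t.
Proof.
elim: n X a t => [|n IH] X a t hX la ht.
  case: (hang_bottom hX _ ht) => [|[-> _]|[-> _]]; [lia|exact: RgLeaf|exact: RgCherry].
have [c [d [t1 [t2 [-> cd pcd hcd h12]]]]] := hang_split hX la ht.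
wlog le_cd : c d t1 t2 cd pcd hcd h12 / le c d.
  move=> H; have [[_ /eqP lc] [_ /eqP ld]] := (andP pcd.1, andP pcd.2).
  have [tot _ _] := ord.1 (lv a).+1 isT.
  have : le c d || le d c by apply: tot; rewrite inE ?lc ?ld.
  case/orP=> [|dc]; first exact: H cd pcd hcd h12.
  apply: RgSwap; apply: (H d c) => //; first by rewrite eq_sym.
  - by case: pcd.
  - by case: hcd.
  - by case: h12.
case: pcd hcd h12 => pc pd [hc hd] [h1 h2].
have /andP[_ /eqP lc] := pc; have /andP[_ /eqP ld] := pd.
have lc' : lv c + n = h by lia.
have ld' : lv d + n = h by lia.
have [/exists_inP[x xl dx]|no] :=
    boolP [exists x in level r h, descendant c x && deepest_parent r x].
  have /andP[cx dpx] := dx; have lx : lv x = h by move: xl; rewrite inE => /eqP.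
  rewrite (hang_deep hd ld' h2); first by apply: RgSecond; apply: IH hc lc' h1.
  move=> y dy ly; apply: (final xl _ dpx); first by rewrite inE ly.
  by rewrite (descendant_order ord _ _ cd cx dy) //; lia.
rewrite (hang_shallow hc lc' h1); first by apply: RgFirst; apply: IH hd ld' h2.
case=> x cx [lx dpx]; move/negP: no; apply; apply/exists_inP; exists x.
  by rewrite inE lx.
by rewrite cx.
Qed.

End Order.
End RgoodShape.

Lemma rg_tree_shape l (R : sgraph) (r : R) : rg_tree l r ->
  arboreal R /\ exists t, [/\ hang set0 r t, l = (leaves t).*2.-1 &
    (root_subtrees t).+1 = rg_val (leaves t)].
Proof.
case=> -[[tR degR] flat [le ord final]] cardR.
have T := tree_arboreal tR; split=> //; have [_ acyc] := tR.
have [t ht] : exists t, hang set0 r t.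
  apply: hang_exists => //; first exact: sub0set.
    rewrite setD0 -/(deg r); case: degR => [R1|[-> _]]; last by right.
    left; apply/eqP; rewrite cards_eq0; apply/eqP/setP=> x; rewrite !inE.
    suff -> : x = r by rewrite adj_irrefl.
    exact: (elimT fintype_le1P (eq_leq R1) r x).
  move=> v _ vr; case: degR => [R1|[_]]; last exact.
  by case/eqP: vr; apply: (elimT fintype_le1P (eq_leq R1) r v).
exists t; split=> //.
  have [_] := hang_card T ht (sub0set _).
  by rewrite comp_setT // cardsT cardR.
case: degR => [R1|[deg_r degR]].
  have [_] := hang_card T ht (sub0set _); rewrite comp_setT // cardsT R1.
  by case: t ht => // t1 t2 _ /=; have := leaves_gt0 t1; have := leaves_gt0 t2; lia.
case hh : (height r) => [|h].
  have [x rx] : exists x, adj r x.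
    have /card_gt0P[x] : 0 < #|[set u | adj r u]| by rewrite -/(deg r) deg_r.
    by rewrite inE; exists x.
  have [_ _ _ /(_ x rx)] := dist_layered T r.
  by have : dist r x <= height r := leq_bigmax x; rewrite hh; lia.
apply: (@root_subtrees_rg_shape h).
apply: (hang_rg_shape T hh deg_r flat ord (final h hh) _ _ ht).
  by left.
by rewrite dist_refl.
Qed.

(* Breadth-first numbering: the children of i are 2i + 1 and 2i + 2. *)
Section Heap.
Variable k : nat.
Notation V := 'I_(k.*2).+1.
Implicit Types i j x y : V.

Definition heap_adj : rel V := fun i j =>
  [|| nat_of_ord j == i.*2.+1, nat_of_ord j == i.*2.+2,
      nat_of_ord i == j.*2.+1 | nat_of_ord i == j.*2.+2].

Lemma heap_adj_sym : symmetric heap_adj.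
Proof. by move=> i j; rewrite /heap_adj; lia. Qed.

Lemma heap_adj_irrefl : irreflexive heap_adj.
Proof. by move=> i; rewrite /heap_adj; lia. Qed.

Definition heap := SGraph heap_adj_sym heap_adj_irrefl.

Definition heap_depth (i : heap) := trunc_log 2 (nat_of_ord i).+1.

Lemma heap_depth_child (i j : heap) :
  nat_of_ord j = i.*2.+1 \/ nat_of_ord j = i.*2.+2 ->
  heap_depth j = (heap_depth i).+1.
Proof.
by rewrite /heap_depth => ji; rewrite trunc_log2S; [congr (trunc_log 2 _).+1|]; lia.
Qed.

Lemma heap_adj_up (i j : heap) : adj i j -> heap_depth j <= heap_depth i ->
  nat_of_ord i = j.*2.+1 \/ nat_of_ord i = j.*2.+2.
Proof.
rewrite /adj /= /heap_adj => ij le_ji.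
suff : ~ (nat_of_ord j = i.*2.+1 \/ nat_of_ord j = i.*2.+2) by lia.
by move/heap_depth_child; lia.
Qed.

Lemma heap_layered : layered (ord0 : heap) heap_depth.
Proof.
split=> [//|x x0|x y z xy xz yx zx|x].
- have xgt0 : 0 < nat_of_ord x.
    by rewrite lt0n; apply: contraNneq x0 => x0; apply/eqP/val_inj.
  have ltx := ltn_ord x.
  have lt_y : x.-1./2 < (k.*2).+1 by lia.
  exists (Ordinal lt_y : heap); first by rewrite /adj /= /heap_adj /=; lia.
  by apply: heap_depth_child => /=; lia.
- by apply: val_inj => /=; have := heap_adj_up xy yx; have := heap_adj_up xz zx; lia.
- rewrite /adj /= /heap_adj /= => x0.
  by rewrite (@heap_depth_child ord0 x) //=; lia.
Qed.

Lemma heap_dist (x : heap) : dist (ord0 : heap) x = heap_depth x.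
Proof. exact: (layered_dist heap_layered). Qed.

Lemma heap_children (x : heap) : x < k -> exists c d : heap,
  nat_of_ord c = x.*2.+1 /\ nat_of_ord d = x.*2.+2.
Proof.
move=> xk; have lc : x.*2.+1 < (k.*2).+1 by lia.
have ld : x.*2.+2 < (k.*2).+1 by lia.
by exists (Ordinal lc), (Ordinal ld).
Qed.

Lemma heap_deg_root : 0 < k -> deg (ord0 : heap) = 2.
Proof.
move=> k0; have [c [d [cE dE]]] := @heap_children ord0 k0.
rewrite /deg (_ : finset _ = [set c; d]).
  by rewrite cards2 (_ : c != d) //; apply/eqP=> cd; move: dE; rewrite -cd cE.
apply/setP=> x; rewrite !inE -!(inj_eq val_inj) /= /adj /= /heap_adj /= cE dE /=; lia.
Qed.

Lemma heap_deg (x : heap) : x != ord0 -> deg x = if x < k then 3 else 1.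
Proof.
move=> x0; have xgt0 : 0 < nat_of_ord x.
  by rewrite lt0n; apply: contraNneq x0 => x0; apply/eqP/val_inj.
have ltx := ltn_ord x; have lt_y : x.-1./2 < (k.*2).+1 by lia.
case: ifP => xk; last first.
  rewrite /deg (_ : finset _ = [set (Ordinal lt_y : heap)]) ?cards1 //.
  apply/setP=> y; rewrite !inE -!(inj_eq val_inj) /= /adj /= /heap_adj /=.
  by have := ltn_ord y; lia.
have [c [d [cE dE]]] := heap_children xk.
rewrite /deg (_ : finset _ = (Ordinal lt_y : heap) |: [set c; d]).
  rewrite cardsU1 cards2 !inE -!(inj_eq val_inj) /= cE dE; lia.
by apply/setP=> y; rewrite !inE -!(inj_eq val_inj) /= /adj /= /heap_adj /= cE dE; lia.
Qed.

Lemma heap_pendant (x : heap) : pendant x -> k <= x.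
Proof.
rewrite /pendant => px; rewrite leqNgt; apply/negP=> xk.
have [x0|x0] := eqVneq x ord0; last by rewrite heap_deg // xk in px.
by move: px; rewrite x0 heap_deg_root //; lia.
Qed.

Lemma heap_parent (p x : heap) : is_parent (ord0 : heap) p x ->
  nat_of_ord x = p.*2.+1 \/ nat_of_ord x = p.*2.+2.
Proof.
rewrite /is_parent !heap_dist => /andP[px /eqP lx].
by apply: heap_adj_up; [rewrite adj_sym|lia].
Qed.

Lemma heap_rgood : rgood (ord0 : heap).
Proof.
split.
- split; first exact: layered_tree heap_layered.
  case: (posnP k) => [k0|k_gt0]; first by left; rewrite card_ord k0.
  by right; split=> [|v /heap_deg->]; [exact: heap_deg_root|case: ifP; tauto].
- move=> x y _ /heap_pendant ky; rewrite !heap_dist /heap_depth.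
  rewrite -trunc_log2_double //; apply: leq_trunc_log.
  by have := ltn_ord x; lia.
(* The numbering is reversed: the last level is filled from its start, so the parents of the deepest
   vertices form an initial segment of the numbering. *)
exists (fun x y : heap => nat_of_ord y <= nat_of_ord x).
  split=> [h _|h _ x y xl yl p q /heap_parent xp /heap_parent yq].
    split=> [x y _ _|x y _ _|x y z _ _ _].
    - exact: leq_total.
    - by rewrite andbC -eqn_leq => /eqP/val_inj.
    - by move=> zx yz; apply: leq_trans yz zx.
  by rewrite -(inj_eq val_inj) /=; lia.
move=> h hh p q pl ql /exists_inP[x _ /andP[_ /heap_parent xp]] qp.
have qk : q < k by have := ltn_ord x; lia.
have lv_max (z : heap) : dist (ord0 : heap) z <= h.+1.
  by rewrite -hh; apply: (leq_bigmax (F := fun z : heap => dist (ord0 : heap) z)).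
have [c [_ [cE _]]] := heap_children qk.
have lc : heap_depth c = (heap_depth q).+1 by apply: heap_depth_child; left.
have lq : heap_depth q = h by move: ql; rewrite inE heap_dist => /eqP.
apply/exists_inP; exists c; first by rewrite inE hh heap_dist lc lq.
rewrite /is_parent !heap_dist lc eqxx andbT /pendant; apply/andP; split; last first.
  by rewrite /adj /= /heap_adj cE eqxx.
rewrite heap_deg; last by rewrite -(inj_eq val_inj) /= cE.
case: ifP => // /heap_children[d [_ [dE _]]].
have := lv_max d; rewrite heap_dist (@heap_depth_child c d); last by left.
by rewrite lc lq; lia.
Qed.

End Heap.

Lemma rg_tree_exists l : odd l -> exists (R : sgraph) (r : R), rg_tree l r.
Proof.
move=> odd_l; exists (heap l./2), ord0; split; first exact: heap_rgood.
by rewrite card_ord -[RHS]odd_double_half odd_l.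
Qed.

(** * Caterpillars *)

Section Caterpillar.
Variable C : sgraph.
Implicit Types (a b c u v x y z : C) (p s : seq C).
Hypothesis T : arboreal C.

Lemma walk_comp v a s : path (@adj C) a s -> v \notin a :: s ->
  {subset a :: s <= comp [set v] a}.
Proof.
rewrite inE negb_or => as_; case/andP=> va v_s x; rewrite inE => /predU1P[->|].
  exact: mem_comp_root.
apply: path_comp; apply: path_avoid => //; first by rewrite inE eq_sym.
by move=> y ys; rewrite inE; apply: contraNneq v_s => <-.
Qed.

Lemma comp_same v a x y : x \in comp [set v] a -> y \in comp [set v] a ->
  y \in comp [set v] x.
Proof.
move=> xa ya; apply: (subsetP (comp_trans _)) ya.
by rewrite inE avoid_sym; move: xa; rewrite inE.
Qed.

Section Spine.
Variables (x0 : C) (p0 : seq C).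
Hypothesis spine_path : path (@adj C) x0 p0.
Hypothesis spine_uniq : uniq (x0 :: p0).
Hypothesis spine_dom :
  forall v, v \notin x0 :: p0 -> exists2 u, u \in x0 :: p0 & adj u v.

(** If [y] is off the spine, its removal leaves the spine in one component. Every neighbour of [y]
    is on the spine or adjacent to it, hence in that same component, so there is only one. *)
Lemma inner_on_spine y a b : adj y a -> adj y b -> a != b -> y \in x0 :: p0.
Proof.
move=> ya yb ab; apply/negPn/negP=> y_p.
have sub := walk_comp spine_path y_p.
have dom q : adj y q -> q \in comp [set y] x0.
  move=> yq; have [/sub//|/spine_dom[u up uq]] := boolP (q \in x0 :: p0).
  apply: (subsetP (comp_trans (sub u up))); apply: comp_step => //.
    by rewrite inE; apply: contraNneq y_p => <-.
  by rewrite inE eq_sym adj_neq.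
case/eqP: ab; apply: (comp_nbr_inj T ya yb (mem_comp_root _ _)).
exact: comp_same (dom b yb) (dom a ya).
Qed.

(** Removing [v] leaves at most two segments of the spine, each within one component; two of the
    three neighbours would share a segment. *)
Lemma spine_degree v a b c : adj v a -> adj v b -> adj v c ->
  a != b -> a != c -> b != c ->
  a \in x0 :: p0 -> b \in x0 :: p0 -> c \in x0 :: p0 -> False.
Proof.
move=> va vb vc ab ac bc ap bp cp.
have same x y : adj v x -> adj v y -> y \in comp [set v] x -> x = y.
  by move=> vx vy; case: T => _; apply.
have inS : exists s1 s2,
    [/\ forall x, adj v x -> x \in x0 :: p0 -> x \in s1 \/ x \in s2,
    {in s1 &, forall x y, y \in comp [set v] x} &
    {in s2 &, forall x y, y \in comp [set v] x}].
  have seg z s : path (@adj C) z s -> v \notin z :: s ->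
      {in z :: s &, forall x y, y \in comp [set v] x}.
    by move=> zs vs x y /(walk_comp zs vs) xz /(walk_comp zs vs); apply: comp_same.
  have [vp|v_p] := boolP (v \in x0 :: p0); last first.
    by exists (x0 :: p0), [::]; split=> [x _ xp||x y //]; [left|apply: seg].
  have := spine_path; have := spine_uniq.
  move: vp; rewrite inE => /predU1P[<-|vp0].
    move=> /= /andP[v_p _] vpath; exists p0, [::]; split=> [x vx||x y //].
      by rewrite inE => /predU1P[xv|]; [rewrite xv adj_irrefl in vx|left].
    by case: p0 v_p vpath => [|z s] // v_p /= /andP[_ zs]; apply: seg.
  case/splitPr: vp0 => p1 p2; rewrite cat_path /= => u12 /and3P[px1 _ vp2].
  move: u12; rewrite cat_uniq /= mem_cat inE !negb_or.
  case/and3P=> /and3P[_ xv _] _ /and3P[/andP[v_p1 _] v_p2 _].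
  exists (x0 :: p1), p2; split.
  - move=> x vx; rewrite -cat_cons mem_cat inE.
    case/or3P=> [|/eqP xE|]; [by left| |by right].
    by rewrite xE adj_irrefl in vx.
  - by apply: seg; rewrite // inE negb_or eq_sym xv.
  - by case: p2 vp2 v_p2 => [|z s] // /andP[_]; apply: seg.
have [s1 [s2 [mem12 in1 in2]]] := inS.
have [] := (mem12 a va ap, mem12 b vb bp, mem12 c vc cp).
move=> [[] a_s [] b_s] [] c_s; solve
 [ by case/eqP: ab; apply: same => //; apply: in1
 | by case/eqP: ab; apply: same => //; apply: in2
 | by case/eqP: ac; apply: same => //; apply: in1
 | by case/eqP: ac; apply: same => //; apply: in2
 | by case/eqP: bc; apply: same => //; apply: in1
 | by case/eqP: bc; apply: same => //; apply: in2 ].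
Qed.

Lemma node_on_spine v y t1 t2 : hang [set v] y (Node t1 t2) -> y \in x0 :: p0.
Proof.
case/hang_node_children=> c [d [cd /set2D_adj[yc yd _ _] _ _]].
exact: inner_on_spine yc yd cd.
Qed.

(** If both children of [v] were inner vertices they would lie on the spine. So does [b], because of
    its second neighbour [b'], and [v] would have three neighbours on the spine. *)
Lemma hang_caterpillar t b v b' : hang [set b] v t -> adj b v -> adj b b' ->
  b' != v -> caterpillar t.
Proof.
elim: t b v b' => // t1 IH1 t2 IH2 b v b' hv bv bb' b'v.
have [y [z [yz eN h1 h2]]] := hang_node_children hv.
have [vy vz yb zb] := set2D_adj eN; rewrite !inE in yb zb.
have vb : adj v b by rewrite adj_sym.
have c1 : caterpillar t1 by apply: IH1 h1 vy vb _; rewrite eq_sym.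
have c2 : caterpillar t2 by apply: IH2 h2 vz vb _; rewrite eq_sym.
rewrite /= c1 c2 !andbT.
case: t1 h1 {IH1 c1 hv} => // t11 t12 /node_on_spine yP.
case: t2 h2 {IH2 c2} => // t21 t22 /node_on_spine zP.
have bP := inner_on_spine bb' bv b'v.
by case: (spine_degree vy vz vb yz yb zb yP zP bP).
Qed.

End Spine.

(** For [w] farthest from [c], maximality of the eccentricity makes [c] farthest from [w]; hence
    each neighbour of [c] is nearer to [w]. *)
Lemma max_ecc_nbr c : (forall u, ecc u <= ecc c) -> 1 < #|C| ->
  exists w, (forall b, adj c b -> dist w c = (dist w b).+1) /\
    (forall b, dist w b <= dist w c).
Proof.
move=> cmax C_gt1; have C_gt0 : 0 < #|C| by apply: ltnW.
have [w wE] := eq_bigmax (fun u => dist u c) C_gt0; exists w.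
have le_w b : dist w b <= dist w c.
  rewrite -wE -/(ecc c); apply: leq_trans (cmax b).
  exact: (leq_bigmax (F := fun u => dist u b)).
split=> // b cb; have [//|bE] := layered_adj (dist_layered T w) cb.
by have := le_w b; rewrite bE ltnn.
Qed.

(** The vertex [c] is pendant and may be off the spine, so the previous argument starts only below
    [c1]. At [c1], a child farther from [w] than [c1] is a leaf, since nothing is farther from [w]
    than [c]; and at most one child is nearer. *)
Lemma caterpillar_end c : binary_caterpillar C -> (forall u, ecc u <= ecc c) ->
  1 < #|C| -> exists c1 t, [/\ nbrs c = [set c1], hang [set c] c1 t & caterpillar t].
Proof.
move=> [[_ degC] [x0 [p0 [sp su sd]]]] cmax C_gt1.
have [w [w_nbr w_max]] := max_ecc_nbr cmax C_gt1.
have Lw := dist_layered T w; have [_ _ uniq_up _] := Lw.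
have [c1 cc1] : exists c1, adj c c1.
  have /card_gt1P[x [y [_ _ xy]]] := C_gt1.
  have [z zc] : exists z, z != c.
    by have [xc|] := eqVneq x c; [exists y; rewrite -xc eq_sym|exists x].
  by have [a ca _] := comp_nbr_exists T zc; exists a.
have nbr1 b : adj c b -> b = c1.
  by move=> cb; apply: (uniq_up c) => //; rewrite ?(w_nbr b cb) ?(w_nbr c1 cc1).
have nbrE : nbrs c = [set c1].
  apply/setP=> b; rewrite !inE; apply/idP/eqP=> [/nbr1//|->//].
have c1c : adj c1 c by rewrite adj_sym.
have deg13 v : deg v = 1 \/ deg v = 3.
  by have [/eqP|] := boolP (pendant v); [left|right; apply: degC].
have [t ht] : exists t, hang [set c] c1 t.
  apply: hang_exists => //; first by rewrite sub1set inE.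
  have := cardsD1 c (nbrs c1); rewrite inE c1c -/(deg c1).
  by case: (deg13 c1) => ->; [left|right]; lia.
exists c1, t; split=> //; case: t ht => // t1 t2 ht.
have [y [z [yz eN h1 h2]]] := hang_node_children ht.
have [vy vz yb zb] := set2D_adj eN; rewrite !inE in yb zb.
have cat1 : caterpillar t1.
  by apply: (hang_caterpillar sp su sd h1 vy c1c); rewrite eq_sym.
have cat2 : caterpillar t2.
  by apply: (hang_caterpillar sp su sd h2 vz c1c); rewrite eq_sym.
rewrite /= cat1 cat2 !andbT.
have top a ta tb : hang [set c1] a (Node ta tb) -> adj c1 a ->
    dist w a = (dist w c1).+1 -> False.
  case/hang_node_children=> d [d' [_ /set2D_adj[ad _ dc1 _] _ _]] c1a la.
  rewrite inE in dc1; have le_d := w_max d; rewrite (w_nbr c1 cc1) in le_d.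
  by case/eqP: dc1; apply: (uniq_up a); rewrite ?la ?leqnSn // adj_sym.
have [ly|ly] := layered_adj Lw vy; last first.
  by case: t1 h1 {cat1 ht} => // ta tb h1; case: (top y ta tb h1 vy ly).
have [lz|lz] := layered_adj Lw vz; last first.
  by case: t2 h2 {cat2 ht} => [|ta tb] h2; [rewrite orbT|case: (top z ta tb h2 vz lz)].
by case/eqP: yz; apply: (uniq_up c1) => //; [rewrite ly|rewrite lz].
Qed.

End Caterpillar.

Lemma imset_set2 (aT rT : finType) (f : aT -> rT) (x y : aT) :
  f @: [set x; y] = [set f x; f y].
Proof. by rewrite imsetU !imset_set1. Qed.

(** * The crg tree *)

Section HangMap.
Variables (H G : sgraph) (f : H -> G).
Hypotheses (TH : arboreal H) (f_inj : injective f).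

Lemma hang_map X a t : hang X a t -> X \subset nbrs a ->
  (forall v, v \in comp X a -> nbrs (f v) = f @: nbrs v) ->
  hang (f @: X) (f a) t.
Proof.
have setDE A B : f @: (A :\: B) = f @: A :\: f @: B.
  apply/setP=> y; rewrite inE; apply/imsetP/andP.
    by case=> x /setDP[xA xB] ->; rewrite !mem_imset.
  case=> yB /imsetP[x xA yE]; exists x => //.
  by rewrite inE xA -(mem_imset B x f_inj) -yE yB.
elim=> {X a t} [X a aX|X a c d t1 t2 cd eN _ IH1 _ IH2] XN nbrE.
  by apply: HangLeaf; rewrite nbrE ?mem_comp_root ?imsetS.
have cN : c \in nbrs a :\: X by rewrite eN set21.
have dN : d \in nbrs a :\: X by rewrite eN set22.
have sub e : e \in nbrs a :\: X -> [set a] \subset nbrs e /\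
    forall v, v \in comp [set a] e -> nbrs (f v) = f @: nbrs v.
  move=> eNX; split; first by move: eNX; rewrite sub1set !inE adj_sym => /andP[].
  by move=> v /(subsetP (comp_child_sub TH XN eNX)); apply: nbrE.
rewrite imset_set1 in IH1; rewrite imset_set1 in IH2.
apply: (@HangNode _ _ _ (f c) (f d)).
- by rewrite (inj_eq f_inj).
- by rewrite nbrE ?mem_comp_root // -setDE eN imset_set2.
- by case: (sub c cN) => *; apply: IH1.
- by case: (sub d dN) => *; apply: IH2.
Qed.

End HangMap.

Section GlueTrees.
Variables (R C : sgraph) (r : R) (c : C).
Hypotheses (TR : arboreal R) (TC : arboreal C).
Notation G := (glue r c).

Definition glue_l (a : R) : G := inl a.

Definition glue_r (y : C) : G :=
  if insub y is Some s then inr s else inl r.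

Lemma glue_r_root : glue_r c = glue_l r.
Proof. by rewrite /glue_r insubF ?eqxx. Qed.

Lemma glue_r_val (s : {v : C | v != c}) : glue_r (val s) = inr s.
Proof. by rewrite /glue_r valK. Qed.

Lemma glue_l_inj : injective glue_l.
Proof. by move=> a b []. Qed.

Lemma glue_r_inj : injective glue_r.
Proof.
move=> x y; rewrite /glue_r; case: insubP => [s _ <-|]; case: insubP => [s' _ <-|] //.
- by case=> ->.
- by rewrite !negbK => /eqP-> /eqP->.
Qed.

Lemma glue_adj_r x y : adj (glue_r x) (glue_r y) = adj x y.
Proof.
rewrite /glue_r; case: insubP => [s _ <-|]; case: insubP => [s' _ <-|]; rewrite ?negbK.
- by [].
- by move/eqP->; rewrite /adj /= eqxx.
- by move/eqP->; rewrite /adj /= eqxx.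
- by move/eqP=> -> /eqP->; rewrite !adj_irrefl.
Qed.

Definition glue_depth (x : G) :=
  match x with inl a => dist r a | inr s => dist c (val s) end.

Lemma glue_depth_r y : glue_depth (glue_r y) = dist c y.
Proof.
rewrite /glue_r; case: insubP => [s _ <-|] //=.
by rewrite negbK => /eqP->; rewrite !dist_refl.
Qed.

Lemma glue_layered : layered (glue_l r) glue_depth.
Proof.
have [_ upR uR rR] := dist_layered TR r; have [_ upC uC rC] := dist_layered TC c.
split=> [|x xr|x y z|x].
- exact: dist_refl.
- case: x xr => [a ar|s sr].
    have {ar} ar : a != r by apply: contraNneq ar => ->.
    by have [b ab lb] := upR a ar; exists (glue_l b).
  have [y sy ly] := upC (val s) (valP s); exists (glue_r y).
    by rewrite -glue_r_val glue_adj_r.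
  by rewrite glue_depth_r.
- case: x => [a|s].
    have inl_nbr (u : G) : adj (inl a : G) u -> glue_depth u <= dist r a ->
        exists2 b, u = glue_l b & adj a b.
      case: u => [b ab _|s /andP[/eqP ar cs]]; first by exists b.
      by rewrite /= ar dist_refl leqNgt rC.
    move=> ay az /[dup] ly /(inl_nbr _ ay)[b yE ab].
    move=> /[dup] lz /(inl_nbr _ az)[b' zE ab'].
    rewrite yE zE in ly lz *; congr glue_l; exact: (uR a).
  have inr_nbr (u : G) : adj (inr s : G) u -> exists2 y, u = glue_r y & adj (val s) y.
    case: u => [b /andP[/eqP-> sc]|s' ss']; first by exists c; rewrite ?glue_r_root.
    by exists (val s'); rewrite ?glue_r_val.
  case/inr_nbr=> y' -> sy /inr_nbr[z' -> sz]; rewrite !glue_depth_r => ly lz.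
  by congr glue_r; apply: (uC (val s)).
- case: x => [a|s]; first exact: rR.
  by case/andP=> _; apply: rC.
Qed.

Lemma glue_nbrs_l a : a != r -> nbrs (glue_l a) = glue_l @: nbrs a.
Proof.
move=> ar; apply/setP=> u; rewrite inE; apply/idP/imsetP=> [|[b]].
  case: u => [b ab|s /andP[]]; first by exists b; rewrite ?inE.
  by rewrite (negbTE ar).
by rewrite inE => ab ->.
Qed.

Lemma glue_nbrs_r y : y != c -> nbrs (glue_r y) = glue_r @: nbrs y.
Proof.
move=> yc; apply/setP=> u; rewrite inE; apply/idP/imsetP=> [|[x]]; last first.
  by rewrite inE => yx ->; rewrite glue_adj_r.
have -> : glue_r y = inr (Sub y yc) by rewrite -glue_r_val SubK.
case: u => [b /andP[/eqP-> sc]|s ss]; first by exists c; rewrite ?inE // glue_r_root.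
by exists (val s); rewrite ?inE ?glue_r_val.
Qed.

Lemma glue_nbrs_root c1 : nbrs c = [set c1] ->
  nbrs (glue_l r) = glue_r c1 |: glue_l @: nbrs r.
Proof.
move=> cE; have cc1 : adj c c1 by have := set11 c1; rewrite -cE inE.
apply/setP=> u; rewrite in_setU1 inE; apply/idP/orP=> [|[/eqP->|/imsetP[b]]].
- case: u => [b rb|s /andP[_ cs]].
    by right; rewrite mem_imset ?inE //; apply: glue_l_inj.
  left; rewrite -glue_r_val (inj_eq glue_r_inj).
  by rewrite -in_set1 -cE inE.
- by rewrite -glue_r_root glue_adj_r.
- by rewrite inE => rb ->.
Qed.

End GlueTrees.

(** The identified vertex counts for the rgood side, so the edge from it to the first vertex of the
    caterpillar separates [l] vertices from [n - l]. *)
Lemma crg_tree_shape n l (G : sgraph) : crg_tree n l G -> arboreal G /\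
  exists (x z : G) (t tc : btree), [/\ adj x z,
    hang [set z] x t /\ (root_subtrees t).+1 = rg_val (leaves t),
    hang [set x] z tc /\ caterpillar tc,
    l = (leaves t).*2.-1 & n - l = (leaves tc).*2.-1].
Proof.
case=> R C r c n_even _ l_odd /andP[l3 ln] rgR catC cardC cmax.
have [TR [t [ht lE tval]]] := rg_tree_shape rgR.
have TC : arboreal C by case: catC => -[/tree_arboreal].
have TG : arboreal (glue r c).
  exact: tree_arboreal (layered_tree (glue_layered r c TR TC)).
split=> //.
have C_gt1 : 1 < #|C| by rewrite cardC addn1 ltnS subn_gt0.
have [c1 [tc [cE htc cat_tc]]] := caterpillar_end TC catC cmax C_gt1.
have cc1 : adj c c1 by have := set11 c1; rewrite -cE inE.
exists (glue_l r c r), (glue_r r c c1), t, tc; split=> //.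
- by rewrite -(glue_r_root r c) glue_adj_r.
- split=> //; case: t ht lE {tval} => [_ /= lE|t1 t2 ht _]; first by rewrite lE in l3.
  have [a [b [ab eN h1 h2]]] := hang_node_children ht.
  have [ra rb _ _] := set2D_adj eN; rewrite setD0 in eN.
  (* The root gains the neighbour [z], so shapes are transported from the children on; at the root
     itself the removed set [[set z]] cancels the new neighbour. *)
  have sub e te : adj r e -> hang [set r] e te ->
      hang [set glue_l r c r] (glue_l r c e) te.
    move=> re he; have := @hang_map _ _ (glue_l r c) TR (@glue_l_inj _ _ r c) _ _ _ he.
    rewrite imset_set1; apply; first by rewrite sub1set inE adj_sym.
    move=> v ve; apply: glue_nbrs_l; apply: contraTneq ve => ->.
    by rewrite comp_opp_notin // adj_sym.
  apply: (@HangNode _ _ _ (glue_l r c a) (glue_l r c b)).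
  + by rewrite (inj_eq (@glue_l_inj _ _ r c)).
  + rewrite (glue_nbrs_root r cE) eN imset_set2 setDUl setDv set0U.
    apply/setDidPl; rewrite disjoint_sym disjoints1 !inE !negb_or.
    have c1c : c1 != c by rewrite eq_sym adj_neq.
    by rewrite -[c1]/(val (Sub c1 c1c : {v | v != c})) glue_r_val.
  + exact: sub.
  + exact: sub.
- split=> //.
  have := @hang_map _ _ (glue_r r c) TC (@glue_r_inj _ _ r c) _ _ _ htc.
  rewrite imset_set1 glue_r_root; apply; first by rewrite sub1set inE adj_sym.
  move=> v vc; apply: glue_nbrs_r; apply: contraTneq vc => ->.
  by rewrite comp_opp_notin // adj_sym.
have [|_ <-] := hang_card TC htc; first by rewrite sub1set inE adj_sym.
have c1c : adj c1 c by rewrite adj_sym.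
have := comp_card TC cc1; rewrite cardC.
suff -> : comp [set c1] c = [set c] by rewrite cards1; lia.
by rewrite -cE comp_nbrs.
Qed.

(** * Distance between centroid and subtree core *)

Section DistSet.
Variable G : sgraph.
Implicit Types X Y : {set G}.

Lemma bigmin_le X (F : G -> nat) x :
  x \in X -> \big[minn/#|G|]_(y in X) F y <= F x.
Proof.
move=> xX; have := mem_index_enum x; elim: (index_enum G) => // y s IH.
rewrite inE big_cons => /predU1P[<-|/IH le]; first by rewrite xX geq_minl.
by case: ifP => // _; apply: leq_trans (geq_minr _ _) le.
Qed.

Lemma le_bigmin X (F : G -> nat) k : k <= #|G| ->
  (forall x, x \in X -> k <= F x) -> k <= \big[minn/#|G|]_(y in X) F y.
Proof.
move=> kG kF; elim/big_ind: _ => // x y kx ky; by rewrite leq_min kx.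
Qed.

Lemma dist_set_le X Y x y : x \in X -> y \in Y -> dist_set X Y <= dist x y.
Proof.
move=> xX yY; apply: (leq_trans (bigmin_le (fun u => _) xX)).
exact: (bigmin_le (dist x) yY).
Qed.

Lemma dist_set_ge X Y k : k <= #|G| ->
  (forall x y, x \in X -> y \in Y -> k <= dist x y) -> k <= dist_set X Y.
Proof.
move=> kG kXY; apply: le_bigmin => // x xX; apply: le_bigmin => // y yY.
exact: kXY.
Qed.

End DistSet.

(** * Locating the subtree core and the centroid *)

Section Core.
Variable G : sgraph.
Implicit Types (a b c d u v x y z : G) (p q : seq G) (X : {set G}).
Hypothesis T : arboreal G.

Lemma conn_sets_gt0 a X : a \notin X -> 0 < #|conn_sets a X|.
Proof.
move=> aX; apply/card_gt0P; exists [set a].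
by rewrite inE set11 !sub1set in_setC aX mem_comp_root.
Qed.

Lemma conn_sets_nbr_le u v y : adj u v -> adj v y -> y != u ->
  #|conn_sets y [set v]| < #|conn_sets v [set u]|.
Proof.
move=> uv vy yu; have vu : adj v u by rewrite adj_sym.
rewrite (@conn_sets_peel _ T v y [set u]) ?sub1set ?inE ?yu //.
rewrite -[X in X < _]mul1n mulnS; have : 0 < #|conn_sets v (y |: [set u])|.
  by apply: conn_sets_gt0; rewrite !inE negb_or !adj_neq.
nia.
Qed.

(* Along a path the number of subtrees is unimodal. *)
Lemma nsubtrees_walk u v p : adj u v -> path (@adj G) v p -> uniq (u :: v :: p) ->
  #|conn_sets v [set u]| <= #|conn_sets u [set v]| ->
  nsubtrees (last v p) <= nsubtrees v.
Proof.
elim: p u v => //= y p IH u v uv /andP[vy yp] /and3P[u_vyp v_yp uyp] le_vu.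
have yu : y != u by apply: contraNneq u_vyp => <-; rewrite !inE eqxx orbT.
have vu : adj v u by rewrite adj_sym.
have lt_y := conn_sets_nbr_le uv vy yu.
have lt_v : #|conn_sets u [set v]| < #|conn_sets v [set y]|.
  by apply: conn_sets_nbr_le; rewrite 1?adj_sym // eq_sym.
have le_y : #|conn_sets y [set v]| <= #|conn_sets v [set y]|.
  exact: leq_trans (ltnW lt_y) (leq_trans le_vu (ltnW lt_v)).
apply: leq_trans (IH v y vy yp _ le_y) _; first by rewrite /= v_yp.
rewrite (nsubtrees_edge T vy) (@nsubtrees_edge _ T y v) 1?adj_sym //.
by rewrite !mulnS [X in _ <= _ + X]mulnC leq_add2r.
Qed.

(** Walking away from the edge on the side of [z], the counts never exceed that of [z], which is
    below that of [x]. *)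
Lemma core_sub x z : adj x z ->
  #|conn_sets z [set x]| < #|conn_sets x [set z]| ->
  subtree_core G \subset comp [set z] x.
Proof.
move=> xz lt_zx; apply/subsetP=> y; apply: contraLR => yC.
have zx : adj z x by rewrite adj_sym.
have : y \in comp [set x] z by rewrite (comp_edgeC T xz) inE.
case/compP=> p [zp lp up]; rewrite inE negb_forall; apply/existsP; exists x.
rewrite -ltnNge; apply: (@leq_ltn_trans (nsubtrees z)).
  rewrite -lp; apply: (nsubtrees_walk xz (path_adj zp)); last exact: ltnW.
  rewrite cons_uniq up andbT inE negb_or adj_neq //=.
  by apply/negP=> /(path_avoid_notin zp); rewrite inE eqxx.
rewrite (nsubtrees_edge T xz) (nsubtrees_edge T zx) !mulnS.
by rewrite [X in _ < _ + X]mulnC ltn_add2r.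
Qed.

Lemma walk_through b a y q : adj b a -> path (@adj G) y q ->
  y \in comp [set b] a -> last y q \notin comp [set b] a -> a \in y :: q.
Proof.
move=> ba yq yC; apply: contraR => a_yq.
have ya : y != a by apply: contraNneq a_yq => ->; rewrite mem_head.
have [s as_ ys] := comp_nbr_exists T ya.
have sb : s != b.
  by apply: contraTneq ys => ->; apply: comp_edge_disj; rewrite 1?adj_sym.
have sub : comp [set a] s \subset comp [set b] a.
  by apply: comp_child_sub => //; rewrite ?sub1set !inE ?sb // adj_sym.
apply: (subsetP sub); apply: (subsetP (comp_trans ys)).
by apply: (walk_comp yq a_yq); apply: mem_last.
Qed.

(* Each step along a caterpillar loses two vertices, so the centroid lies deep
   inside when the caterpillar is heavy. *)
Lemma caterpillar_centroid b a t k : adj b a -> hang [set b] a t -> caterpillar t ->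
  #|G| + 4 * k < 2 * #|comp [set b] a| ->
  forall y q, y \in centroid G -> path (@adj G) y q ->
  last y q \notin comp [set b] a -> k < size q.
Proof.
elim: k b a t => [|k IH] b a t ba ht cat_t heavy y q yC yq lq.
  have lt_ab : #|comp [set a] b| < #|comp [set b] a|.
    by have := comp_card T ba; move: heavy; clear; lia.
  have := subsetP (centroid_sub T ba lt_ab) y yC.
  by case: q lq {yq} => //= /negbTE->.
have Xa : [set b] \subset nbrs a by rewrite sub1set inE adj_sym.
have [_ sz] := hang_card T ht Xa.
(* Passing to the child [s] loses [a] and its other child, a leaf. The condition doubles the size of
   the side, whence the coefficient 4. *)
have heavy_child s ts : hang [set a] s ts -> adj a s -> s != b ->
    (leaves t) = (leaves ts).+1 -> caterpillar ts -> k.+1 < size q.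
  move=> hs as_ sb leavesE cat_s.
  have [|_ szs] := hang_card T hs; first by rewrite sub1set inE adj_sym.
  have leaves0 := leaves_gt0 ts.
  have heavy_s : #|G| + 4 * k < 2 * #|comp [set a] s|.
    by rewrite szs; move: heavy leaves0; rewrite sz leavesE; clear; lia.
  have sub : comp [set a] s \subset comp [set b] a.
    by apply: comp_child_sub => //; rewrite ?sub1set !inE ?sb.
  have lt_as : #|comp [set s] a| < #|comp [set a] s|.
    by have := comp_card T as_; move: heavy_s; clear; lia.
  have ys := subsetP (centroid_sub T as_ lt_as) y yC.
  have yb := subsetP sub y ys.
  have aC : a \notin comp [set a] s by rewrite comp_opp_notin // adj_sym.
  have ya : a != y by apply: contraNneq aC => ay; rewrite {1}ay.
  have := walk_through ba yq yb lq; rewrite inE (negbTE ya) /= => aq.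
  case/splitPr: aq yq lq => q1 q2; rewrite cat_path last_cat size_cat /=.
  case/and3P=> yq1 e1 _ lq.
  have q1_gt : k < size (rcons q1 a).
    apply: (IH a s ts as_ hs cat_s heavy_s y) => //; last by rewrite last_rcons.
    by rewrite rcons_path yq1.
  (* As [a] still lies in the side that the walk has to leave, there is a step beyond [a]; this is
     the additional unit over the induction hypothesis. *)
  case: q2 lq => [|u q2] /= lq; first by rewrite mem_comp_root in lq.
  rewrite size_rcons ltnS in q1_gt; rewrite !addnS !ltnS.
  exact: leq_trans q1_gt (leq_addr _ _).
case: t ht cat_t sz heavy_child => [_ _ sz _|t1 t2 ht cat_t sz heavy_child].
  by move: heavy; rewrite sz /=; clear; lia.
have [c [d [_ eN h1 h2]]] := hang_node_children ht.
have [ac ad cb db] := set2D_adj eN; rewrite !inE in cb db.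
case/orP: cat_t => /andP[leaf_i cat_i].
  by case: t1 leaf_i {ht sz h1} heavy_child => // _ H; apply: (H d t2).
by case: t2 leaf_i {ht sz h2} heavy_child => // _ H; apply: (H c t1); rewrite //= addn1.
Qed.

Hypothesis deg13 : forall v : G, deg v = 1 \/ deg v = 3.

(** The inner vertex [b] has degree 3, so the side gains [b] and its third neighbour. *)
Lemma comp_growth a b c : adj a b -> adj b c -> a != c ->
  #|comp [set b] a| + 2 <= #|comp [set c] b|.
Proof.
move=> ab bc ac; have ba : adj b a by rewrite adj_sym.
have cN : c \in nbrs b by rewrite inE.
have aN : a \in nbrs b :\: [set c] by rewrite !inE ac.
have cX : [set c] \subset nbrs b by rewrite sub1set.
have [eC dis] := comp_peel T cX aN.
have [d [db bd da dc]] : exists d, [/\ d != b, adj b d, d != a & d != c].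
  have := cardsD1 c (nbrs b); rewrite cN (cardsD1 a (nbrs b :\ c)) aN -/(deg b).
  move=> degE; have /card_gt0P[d] : 0 < #|nbrs b :\: [set c] :\ a|.
    by move: degE; case: (deg13 b) => ->; clear; lia.
  by rewrite !inE => /and3P[da dc bd]; exists d; rewrite da dc bd eq_sym adj_neq.
have le2 : 2 <= #|comp (a |: [set c]) b|.
  suff /subset_leq_card : [set b; d] \subset comp (a |: [set c]) b.
    by rewrite cards2 eq_sym db.
  rewrite subUset !sub1set mem_comp_root.
  apply: comp_step => //; rewrite !inE negb_or ?da ?dc //.
  by rewrite (adj_neq ba) (adj_neq bc).
rewrite eC cardsU disjoint_setI0 // cards0 subn0 addnC.
by rewrite leq_add2r.
Qed.

Lemma path_growth p a b : adj a b -> path (@adj G) b p -> uniq (a :: b :: p) ->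
  #|comp [set b] a| + 2 * size p <=
    #|comp [set last b p] (last a (belast b p))|.
Proof.
elim: p a b => [|c p IH] a b ab; first by rewrite addn0.
case/andP=> bc cp /andP[a_p up]; have ac : a != c.
  by apply: contraNneq a_p => ->; rewrite !inE eqxx orbT.
apply: leq_trans (IH b c bc cp up); rewrite mulnS addnA leq_add2r.
exact: comp_growth.
Qed.

End Core.

(** * Comparison of an arbitrary binary tree with the crg tree *)

Lemma dist_path_uniq (G : sgraph) (x y : G) : connect (@adj G) x y ->
  exists p, [/\ path (@adj G) x p, last x p = y, size p = dist x y & uniq (x :: p)].
Proof.
case/dist_path=> p [xp lp sp]; case/shortenP: xp lp => q xq uq sub lq.
exists q; split=> //; apply/eqP; rewrite eqn_leq -{2}lq dist_le // andbT -sp.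
by apply: uniq_leq_size sub; case/andP: uq.
Qed.

Lemma nsubtrees_hang (G : sgraph) (r : G) t : arboreal G -> hang set0 r t ->
  nsubtrees r = root_subtrees t.
Proof.
by move=> T /(hang_card T)/(_ (sub0set _))[cardE _]; rewrite nsubtreesE.
Qed.

Lemma rg_exceeds_core (G : sgraph) (w x : G) : arboreal G ->
  (forall v : G, deg v = 1 \/ deg v = 3) -> adj w x ->
  w \in subtree_core G -> x \notin subtree_core G ->
  odd #|comp [set x] w| /\ rg_exceeds #|G| #|comp [set x] w|.
Proof.
move=> T deg13 wx wC xC; have xw : adj x w by rewrite adj_sym.
have branch_exists (a b : G) : adj a b -> exists t, hang [set a] b t.
  move=> ab; apply: (hang_exists T) => [||v _ _]; last exact: deg13.
    by rewrite sub1set inE adj_sym.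
  have := cardsD1 a (nbrs b); rewrite inE [adj b a]adj_sym ab -/(deg b).
  by case: (deg13 b) => ->; [left|right]; lia.
have [tx hx] := branch_exists w x wx; have [tw hw] := branch_exists x w xw.
have [|Mx Cx] := hang_card T hx; first by rewrite sub1set inE.
have [|Mw Cw] := hang_card T hw; first by rewrite sub1set inE.
have leaves_w := leaves_gt0 tw; have leaves_x := leaves_gt0 tx.
have odd_w : odd #|comp [set x] w| by rewrite Cw; move: leaves_w; clear; lia.
split=> //; have [R [r rgR]] := rg_tree_exists odd_w; exists R, r; split=> //.
have [TR [t [ht lE tval]]] := rg_tree_shape rgR.
have leavesE : leaves t = leaves tw.
  by have := leaves_gt0 t; move: lE leaves_w; rewrite Cw; clear; lia.
have := core_step T wx wC xC; rewrite Mx Mw (nsubtrees_hang TR ht) => lt_xw.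
have ge_x := root_subtrees_ge tx; have le_w := root_subtrees_le tw.
(* The side of [x] is a full binary tree, with one vertex less than twice its leaves; the threshold
   is thus the caterpillar bound for that side. *)
have -> : (#|G| - #|comp [set x] w| - 1) %/ 2 = (leaves tx).-1.
  by rewrite -(comp_card T xw) Cx divn2; move: leaves_x; clear; lia.
by move: lt_xw ge_x le_w; rewrite -leavesE -tval; clear; lia.
Qed.

Lemma core_centroid_path (G : sgraph) (u w : G) : arboreal G ->
  (forall v : G, deg v = 1 \/ deg v = 3) ->
  u \in centroid G -> w \in subtree_core G -> 1 < dist u w ->
  (forall u' w', u' \in centroid G -> w' \in subtree_core G ->
     dist u w <= dist u' w') ->
  exists m, [/\ odd m, rg_exceeds #|G| m & 2 * m + 4 * (dist u w).-1 < #|G|].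
Proof.
move=> T deg13 uC wC d2 dmin; have [conn _] := T.
have [p [up lp sp uniq_p]] := dist_path_uniq (conn u w).
case: p up lp sp uniq_p => [|v1 p] up lp sp uniq_p; first by rewrite -sp in d2.
case/andP: (up) => uv1 v1p; rewrite [last _ _]/= in lp.
have v1C : v1 \notin centroid G.
  apply/negP=> v1C; have := dmin v1 w v1C wC.
  by have := dist_le v1p; rewrite lp -sp /=; clear; lia.
have heavy := centroid_step T uv1 uC v1C.
have growth := path_growth T deg13 uv1 v1p uniq_p; rewrite lp in growth.
set x := last u (belast v1 p) in growth.
have ux : path (@adj G) u (belast v1 p).
  by move: up; rewrite (lastI v1 p) rcons_path => /andP[].
have xw : adj x w by move: up; rewrite (lastI v1 p) rcons_path lp => /andP[].
have xC : x \notin subtree_core G.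
  apply/negP=> xC; have := dmin u x uC xC.
  by have := dist_le ux; rewrite -/x size_belast -sp /=; clear; lia.
have wx : adj w x by rewrite adj_sym.
have [odd_m ex_m] := rg_exceeds_core T deg13 wx wC xC.
exists #|comp [set x] w|; split=> //.
have := comp_card T uv1; have := comp_card T xw.
by move: heavy growth; rewrite -sp /=; clear; lia.
Qed.

(** The hypothesis is [n + 4 * k < 2 * (n - l)], the margin that [caterpillar_centroid] asks of the
    caterpillar side. As the threshold is exactly the count at the end of that caterpillar,
    exceeding it keeps the core on the other side. *)
Lemma crg_tree_dist n l (G : sgraph) k : crg_tree n l G -> rg_exceeds n l ->
  #|G| = n -> 2 * l + 4 * k < n -> k < dist_set (centroid G) (subtree_core G).
Proof.
move=> /crg_tree_shape[T [x [z [t [tc [xz [ht tval] [htc cat_tc] lE nlE]]]]]].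
case=> R [r [rgR exceeds]] cardG heavy.
have zx : adj z x by rewrite adj_sym.
have [|Mx Cx] := hang_card T ht; first by rewrite sub1set inE.
have [|Mz Cz] := hang_card T htc; first by rewrite sub1set inE.
have [TR [t' [ht' lE' tval']]] := rg_tree_shape rgR.
have leavesE : leaves t' = leaves t.
  have := leaves_gt0 t; have := leaves_gt0 t'.
  by move: lE'; rewrite lE; clear; lia.
have leaves_c := leaves_gt0 tc.
have core_x : subtree_core G \subset comp [set z] x.
  apply: core_sub => //; rewrite Mx Mz.
  move: exceeds; rewrite (nsubtrees_hang TR ht') nlE.
  have -> : ((leaves tc).*2.-1 - 1) %/ 2 = (leaves tc).-1.
    by rewrite divn2; move: leaves_c; clear; lia.
  have := root_subtrees_caterpillar cat_tc.
  by rewrite leavesE -tval in tval'; move: tval'; clear; lia.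
have [conn _] := T.
apply: dist_set_ge => [|y w yC wC]; first by rewrite cardG; move: heavy; clear; lia.
have [q [yq lq <-]] := dist_path (conn y w).
apply: (caterpillar_centroid T xz htc cat_tc _ yC yq).
  by rewrite Cz -nlE cardG; move: heavy; clear; lia.
by rewrite lq comp_edge_disj // (subsetP core_x).
Qed.

Lemma card_crg_tree n l (G : sgraph) : crg_tree n l G -> #|G| = n.
Proof.
move/crg_tree_shape=> [T [x [z [t [tc [xz [ht _] [htc _] lE nlE]]]]]].
have [|_ Cx] := hang_card T ht; first by rewrite sub1set inE.
have [|_ Cz] := hang_card T htc; first by rewrite sub1set inE adj_sym.
have := comp_card T xz; rewrite Cx Cz -lE -nlE.
by have := leaves_gt0 tc; move: nlE; clear; lia.
Qed.

Theorem theorem3p12 (n : nat) (T : sgraph) (l : nat) (Trg : sgraph) :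
  binary_tree T -> #|T| = n -> 12 <= n ->
  least_rg_size n l ->
  crg_tree n l Trg ->
  let alpha := dist_set (centroid Trg) (subtree_core Trg) in
  dist_set (centroid T) (subtree_core T) <= (if 1 <= alpha then alpha else 1).
Proof.
move=> [treeT degT] cardT n12 [_ exceeds_l least_l] crg.
cbv zeta; set alpha := dist_set (centroid Trg) _.
have arbT := tree_arboreal treeT.
have deg13 (v : T) : deg v = 1 \/ deg v = 3.
  by have [/eqP|] := boolP (pendant v); [left|right; apply: degT].
have [v0 _] : exists v0 : T, v0 \in T.
  by apply/card_gt0P; rewrite cardT; apply: leq_trans n12.
pose cc (p : T * T) := (p.1 \in centroid T) && (p.2 \in subtree_core T).
have [u0 u0C] : exists u, u \in centroid T.
  exists [arg min_(v < v0) weight v]; rewrite inE; case: arg_minnP => // v _ vmin.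
  by apply/forallP=> u; apply: vmin.
have [w0 w0C] : exists w, w \in subtree_core T.
  exists [arg max_(v > v0) nsubtrees v]; rewrite inE; case: arg_maxnP => // v _ vmax.
  by apply/forallP=> u; apply: vmax.
have cc0 : cc (u0, w0) by rewrite /cc u0C.
case: (arg_minnP (fun p : T * T => dist p.1 p.2) cc0) => -[u w] /andP[/= uC wC] dmin.
apply: leq_trans (dist_set_le uC wC) _.
(* A distance of at most 1 is within the bound whatever [alpha] is. *)
have [le1|gt1] := leqP (dist u w) 1; first by case: ifP => //; apply: leq_trans.
have [|m [odd_m ex_m lt_m]] := core_centroid_path arbT deg13 uC wC gt1.
  by move=> u' w' u'C w'C; apply: (dmin (u', w')); rewrite /cc u'C.
rewrite cardT in ex_m lt_m; have le_lm := least_l m odd_m ex_m.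
(* The lower bound in the crg tree is strict, so [k] is one less than the distance; the inequality
   passes from [m] to [l] by minimality of [l]. *)
have lt_alpha : (dist u w).-1 < alpha.
  apply: (crg_tree_dist crg exceeds_l (card_crg_tree crg)).
  by move: lt_m le_lm; clear; lia.
have -> : 0 < alpha by apply: leq_ltn_trans lt_alpha.
by move: lt_alpha; clear; lia.
Qed.
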